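(* Let $(u_n^{\varepsilon},p_n^{\varepsilon})_{n\ge 0}$ satisfy the variable-step artificial compression method: for all $n\ge 0$, $$\frac{u_{n+1}^{\varepsilon}-u_n^{\varepsilon}}{k_{n+1}}+(u_{n+1}^{\varepsilon}\cdot\nabla)u_{n+1}^{\varepsilon}+\tfrac12(\nabla\cdot u_{n+1}^{\varepsilon})u_{n+1}^{\varepsilon}-\nu\Delta u_{n+1}^{\varepsilon}+\nabla p_{n+1}^{\varepsilon}=f_{n+1},$$ $$\frac12\,\frac{\varepsilon_{n+1}p_{n+1}^{\varepsilon}-\varepsilon_np_n^{\varepsilon}}{k_{n+1}}+\frac{\varepsilon_n}{2}\,\frac{p_{n+1}^{\varepsilon}-p_n^{\varepsilon}}{k_{n+1}}+\nabla\cdot u_{n+1}^{\varepsilon}=0\quad\text{in }\Omega,$$ with $u_0^{\varepsilon}=u_0$, $p_0^{\varepsilon}=p_0$ in $\Omega$ and $u_n^{\varepsilon}=0$ on $\partial\Omega$ for $n\ge1$. Then the method is unconditionally, long time stable; namely, with no restriction on the positive sequences $(\varepsilon_n)$, $(k_n)$, for any $N>0$ the energy equality $$\frac12\int_\Omega |u_N^{\varepsilon}|^2+\varepsilon_N|p_N^{\varepsilon}|^2\,dx+\sum_{n=0}^{N-1}\left[\int_\Omega\frac12|u_{n+1}^{\varepsilon}-u_n^{\varepsilon}|^2+\frac{\varepsilon_n}{2}(p_{n+1}^{\varepsilon}-p_n^{\varepsilon})^2+k_{n+1}\nu|\nabla u_{n+1}^{\varepsilon}|^2\,dx\right]$$ $$=\frac12\int_\Omega|u_0|^2+\varepsilon_0|p_0|^2\,dx+\sum_{n=0}^{N-1}k_{n+1}\int_\Omega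 u_{n+1}^{\varepsilon}\cdot f_{n+1}\,dx$$ holds, and the stability bound $$\frac12\int_\Omega |u_N^{\varepsilon}|^2+\varepsilon_N|p_N^{\varepsilon}|^2\,dx+\sum_{n=0}^{N-1}\left[\int_\Omega\frac12|u_{n+1}^{\varepsilon}-u_n^{\varepsilon}|^2+\frac{\varepsilon_n}{2}(p_{n+1}^{\varepsilon}-p_n^{\varepsilon})^2+k_{n+1}\frac{\nu}{2}|\nabla u_{n+1}^{\varepsilon}|^2\,dx\right]$$ $$\le\frac12\int_\Omega|u_0|^2+\varepsilon_0|p_0|^2\,dx+\sum_{n=0}^{N-1}k_{n+1}\frac{1}{2\nu}\|f_{n+1}\|_{-1}^2$$ holds.
   Context: $\Omega$ is a bounded open subset of $\mathbb{R}^3$ or $\Omega=\mathbb{R}^3$ (in which case there is no boundary condition). $\nu>0$ is the viscosity; $k_n>0$ are the timesteps and $\varepsilon_n>0$ the artificial compression parameters, both allowed to vary arbitrarily with $n$. The superscript $\varepsilon$ is only a label. The scheme is discrete in time and continuous in space: $u_0\in L^2(\Omega)^3$, $p_0\in L^2(\Omega)$ and, for $n\ge 1$, $u_n^{\varepsilon}\in H_0^1(\Omega)^3$, $p_n^{\varepsilon}\in L^2(\Omega)$, with the momentum equation understood in the usual weak form tested against $H_0^1(\Omega)^3$ functions. The body forces $f_n$ have finite norm $\|f\|_{-1}=\sup\{\int_\Omega f\cdot v\,dx:\ v\in H_0^1(\Omega)^3,\ \|\nabla v\|_{L^2}\le 1\}$, and $\int_\Omega u\cdot f\,dx$ denotes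 the corresponding duality pairing. *)

(* Defs.v *)
From HB Require Import structures.
From mathcomp Require Import all_boot all_order all_algebra.
From mathcomp Require Import all_classical all_reals all_analysis.
Set Implicit Arguments.
Unset Strict Implicit.
Unset Printing Implicit Defensive.
Import Order.TTheory GRing.Theory Num.Theory.
Import numFieldNormedType.Exports.
Local Open Scope classical_set_scope.
Local Open Scope ring_scope.

(* MathComp-Analysis has no Lebesgue measure on 'rV[R]_n: the points of the
   three-dimensional space are triples, measured by the iterated product
   measure; vector fields take their values in 'rV[R]_3. *)
Notation R3 R :=
  (measurableTypeR R * measurableTypeR R * measurableTypeR R)%type.

Definition mu3 (R : realType) : {measure set (R3 R) -> \bar R} :=
  (((@lebesgue_measure R) \x (@lebesgue_measure R)) \x (@lebesgue_measure R))%E.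

Section Fields.
Context {R : realType}.
Implicit Types (Omega : set (R3 R)) (v w : R3 R -> 'rV[R]_3)
  (Dv Dw : R3 R -> 'M[R]_3) (phi q : R3 R -> R) (g : R3 R -> 'rV[R]_3).

Definition basis3 (i : 'I_3) : R3 R :=
  ((val i == 0%N)%:R, (val i == 1%N)%:R, (val i == 2%N)%:R).

Definition dotv (a b : 'rV[R]_3) : R := \sum_(i < 3) a 0 i * b 0 i.

(* Frobenius product A : B *)
Definition dotm (A B : 'M[R]_3) : R := \sum_(i < 3) \sum_(j < 3) A i j * B i j.

Definition partial (i : 'I_3) phi : R3 R -> R := fun x => 'D_(basis3 i) phi x.

Definition grad phi : R3 R -> 'rV[R]_3 := fun x => \row_i partial i phi x.

Definition smooth phi : Prop := forall s : seq 'I_3,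
  continuous (foldr partial phi s) /\
  forall (i : 'I_3) (x : R3 R), derivable (foldr partial phi s) x (basis3 i).

Definition test_function Omega phi : Prop :=
  [/\ smooth phi, compact (closure [set x | phi x != 0])
    & closure [set x | phi x != 0] `<=` Omega].

Definition L2 Omega q : Prop :=
  measurable_fun Omega q /\
  (@mu3 R).-integrable Omega (fun x => (q x ^+ 2)%:E).

Definition L2v Omega v : Prop := forall i : 'I_3, L2 Omega (fun x => v x 0 i).

Definition weak_grad Omega q g : Prop :=
  forall phi, test_function Omega phi -> forall i : 'I_3,
    \int[@mu3 R]_(x in Omega) (q x * partial i phi x) =
    - \int[@mu3 R]_(x in Omega) (g x 0 i * phi x).

(* q belongs to H^1(Omega) and g is (a representative of) its weak gradient.
   Sobolev functions are handled throughout as pairs (function, gradient): the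
   gradient is unique only up to a negligible set. *)
Definition H1 Omega q g : Prop :=
  [/\ L2 Omega q, L2v Omega g & weak_grad Omega q g].

Definition H1norm Omega q g : R :=
  Num.sqrt (\int[@mu3 R]_(x in Omega) (q x ^+ 2 + dotv (g x) (g x))).

(* H^1_0(Omega) is the closure of the test functions in H^1(Omega). *)
Definition H10 Omega q g : Prop :=
  H1 Omega q g /\
  exists phi : nat -> R3 R -> R, (forall k, test_function Omega (phi k)) /\
    H1norm Omega (fun x => phi k x - q x) (fun x => grad (phi k) x - g x)
      @[k --> \oo] --> (0 : R).

(* Row i of Dv is the gradient of the i-th component of v, that is
   Dv x i j = d_j v_i (x). *)
Definition H10v Omega v Dv : Prop :=
  forall i : 'I_3, H10 Omega (fun x => v x 0 i) (fun x => row i (Dv x)).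

Definition div Dv : R3 R -> R := fun x => \tr (Dv x).

(* (v . grad) w, whose i-th component is \sum_j v_j d_j w_i *)
Definition advection v Dw : R3 R -> 'rV[R]_3 := fun x => v x *m (Dw x)^T.

Definition L2norm_grad Omega Dv : R :=
  Num.sqrt (\int[@mu3 R]_(x in Omega) dotm (Dv x) (Dv x)).

Definition Hm1norm Omega (f : (R3 R -> 'rV[R]_3) -> R) : \bar R :=
  ereal_sup [set (f v)%:E | v in
    [set v | exists2 Dv, H10v Omega v Dv & L2norm_grad Omega Dv <= 1]].

(* f v stands for the duality pairing \int_Omega f . v. Linearity and finiteness
   of the norm force f to be compatible with almost everywhere equality. *)
Definition Hm1 Omega (f : (R3 R -> 'rV[R]_3) -> R) : Prop :=
  (forall (a : R) v Dv w Dw, H10v Omega v Dv -> H10v Omega w Dw ->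
     f (fun x => a *: v x + w x) = a * f v + f w) /\
  (Hm1norm Omega f < +oo)%E.

End Fields.

(* Main.v *)
Require Import Defs.
From HB Require Import structures.
From mathcomp Require Import all_boot all_order all_algebra.
From mathcomp Require Import all_classical all_reals all_analysis.
From mathcomp Require Import measurable_realfun ring lra.
Import Order.TTheory GRing.Theory Num.Theory.
Import numFieldNormedType.Exports.
Set Implicit Arguments.
Unset Strict Implicit.
Unset Printing Implicit Defensive.
Local Open Scope classical_set_scope.
Local Open Scope ring_scope.

(** Testing the momentum equation with [u_{n+1}] and multiplying the continuity
    equation by [p_{n+1}] gives the energy equality of one step
    ([energy_step]): the polarization identity
    [2 (a - b) . a = |a|^2 - |b|^2 + |a - b|^2] produces the increments of the
    kinetic energy, and the two time differences of the continuity equation are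
    weighted so that the pressure work [- \int p_{n+1} div u_{n+1}] is an exact
    increment of [eps_n |p_n|^2 / 2] plus the numerical dissipation
    [eps_n (p_{n+1} - p_n)^2 / 2], whatever the variation of [eps] and [k].
    Summing over the steps gives the equality. For the bound, the forcing is at
    most [||f||_{-1} ||grad u||] ([Hm1_le]), and Young's inequality absorbs half
    of the viscous dissipation.

    The analytic content is that the nonlinear term does no work
    ([skew_advection]). It is half of the sum over i, j of the integrals of
    [d_j (u_j u_i u_i)], so it suffices that [\int d_i (a b c) = 0] for a, b, c
    in H^1_0 ([integral_partial_mul3]). If b and c are test functions this is the
    definition of the weak derivative of a, tested with [b c]. The passage from a
    test function to c in H^1_0 only needs the Cauchy-Schwarz inequality, but the
    last one, for b, involves products such as [c b_n] that must converge in L^2: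
    it needs convergence in L^4.

    That is supplied by Ladyzhenskaya's inequality
    [\int phi^4 <= 4 (||phi||_{L^2}^2 + ||grad phi||_{L^2}^2)^2] for test
    functions ([Ladyzhenskaya]). On each line parallel to an axis,
    [phi^2 <= \int |2 phi d_i phi|] by the fundamental theorem of calculus. On a
    horizontal plane, bounding one factor of [phi^4 = phi^2 phi^2] along each
    horizontal axis yields a product of two plane integrals
    [\int |2 phi d_i phi|], each controlled by the Cauchy-Schwarz inequality; the
    vertical direction bounds [\int phi^2] on the plane uniformly, and the result
    is integrated over the planes. A truncation argument ([quadint_limit]) carries
    the inequality over to H^1_0, and applying it to [phi_n - q] turns H^1
    convergence into L^4 convergence ([test_approx_L4cvg]). *)

(** * Square-integrable functions *)

Section SquareIntegrable.
Context d (T : measurableType d) (R : realType).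
Variables (mu : {measure set T -> \bar R}) (D : set T).
Hypothesis mD : measurable D.
Implicit Types f g h : T -> R.

Local Notation intble f := (mu.-integrable D (EFin \o f)).

(** [L2 Omega q] is convertible to [sqint (@mu3 R) Omega q]. *)
Definition sqint f := measurable_fun D f /\ intble (fun x => f x ^+ 2).

Lemma intble_measurable f : intble f -> measurable_fun D f.
Proof. by move=> /measurable_int /measurable_EFinP. Qed.

Lemma intbleD f g : intble f -> intble g -> intble (fun x => f x + g x).
Proof. by move=> If Ig; have := integrableD mD If Ig. Qed.

Lemma intbleZ a f : intble f -> intble (fun x => a * f x).
Proof. by move=> If; have := integrableZl mD a If. Qed.

Lemma intble_sum n (F : 'I_n -> T -> R) : (forall i, intble (F i)) ->
  intble (fun x => \sum_i F i x).
Proof.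
move=> Fi; rewrite (_ : _ \o _ = fun x => (\sum_i (F i x)%:E)%E).
  by apply: (integrable_sum mD) => i _; exact: Fi.
by apply/funext => x /=; rewrite sumEFin.
Qed.

Lemma Rintegral_sum n (F : 'I_n -> T -> R) : (forall i, intble (F i)) ->
  \int[mu]_(x in D) (\sum_i F i x) = \sum_i \int[mu]_(x in D) F i x.
Proof.
move=> Fi; rewrite /Rintegral; under eq_integral do rewrite -sumEFin.
rewrite integral_sum//= -sum_fine// => i _.
exact: (integrable_fin_num mD (Fi i)).
Qed.

Lemma le_intble f g : measurable_fun D f -> (forall x, D x -> `|f x| <= g x) ->
  intble g -> intble f.
Proof.
move=> mf fg; apply: le_integrable => //; first exact/measurable_EFinP.
by move=> x Dx /=; rewrite lee_fin (le_trans (fg _ Dx))// ler_norm.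
Qed.

Lemma sqintM f g : sqint f -> sqint g -> intble (fun x => f x * g x).
Proof.
move=> [mf f2] [mg g2]; apply: le_intble (intbleD f2 g2).
  exact: measurable_funM.
move=> x _; rewrite normrM -(real_normK (num_real (f x))).
rewrite -(real_normK (num_real (g x))).
have := sqr_ge0 (`|f x| - `|g x|).
have := normr_ge0 (f x); have := normr_ge0 (g x); nra.
Qed.

Lemma sqintZ a f : sqint f -> sqint (fun x => a * f x).
Proof.
move=> [mf f2]; split; first exact: measurable_funM.
have := intbleZ (a ^+ 2) f2; congr (mu.-integrable D _).
by apply/funext => x /=; rewrite exprMn.
Qed.

Lemma sqintD f g : sqint f -> sqint g -> sqint (fun x => f x + g x).
Proof.
move=> Sf Sg; split; first by apply: measurable_funD; [case: Sf|case: Sg].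
have [_ f2] := Sf; have [_ g2] := Sg.
have := intbleD (intbleD f2 g2) (intbleZ 2 (sqintM Sf Sg)).
by congr (mu.-integrable D _); apply/funext => x /=; congr EFin; ring.
Qed.

Lemma sqintB f g : sqint f -> sqint g -> sqint (fun x => f x - g x).
Proof.
move=> Sf Sg; have := sqintD Sf (sqintZ (-1) Sg).
by congr sqint; apply/funext => x; rewrite mulN1r.
Qed.

Lemma Rintegral_lin3 f g h : intble f -> intble g -> intble h ->
  forall a b c, \int[mu]_(x in D) (a * f x + b * g x + c * h x) =
  a * \int[mu]_(x in D) f x + b * \int[mu]_(x in D) g x
  + c * \int[mu]_(x in D) h x.
Proof.
move=> If Ig Ih a b c; rewrite RintegralD//;
  [|exact: intbleD (intbleZ _ _) (intbleZ _ _)|exact: intbleZ].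
rewrite RintegralD//; try exact: intbleZ.
by rewrite !RintegralZl.
Qed.

(** The quadratic form [\int (s f + t g)^2] in s, t is nonnegative, so its
    discriminant is nonpositive. *)
Lemma Rintegral_CauchySchwarz f g : sqint f -> sqint g ->
  (\int[mu]_(x in D) (f x * g x)) ^+ 2 <=
  \int[mu]_(x in D) (f x ^+ 2) * \int[mu]_(x in D) (g x ^+ 2).
Proof.
move=> Sf Sg; have If := Sf.2; have Ig := Sg.2; have Ifg := sqintM Sf Sg.
set A := \int[mu]_(x in D) (f x ^+ 2); set C := \int[mu]_(x in D) (g x ^+ 2).
set B := \int[mu]_(x in D) (f x * g x).
have A0 : 0 <= A by apply: Rintegral_ge0 => x _; exact: sqr_ge0.
have C0 : 0 <= C by apply: Rintegral_ge0 => x _; exact: sqr_ge0.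
have H s t : 0 <= s ^+ 2 * A + (2 * s * t) * B + t ^+ 2 * C.
  rewrite -Rintegral_lin3//; apply: Rintegral_ge0 => x _.
  by have := sqr_ge0 (s * f x + t * g x); nra.
have [C00|Cn0] := eqVneq C 0; last first.
  have Cp : 0 < C by rewrite lt_def Cn0.
  (* The minimizer of the form is proportional to (C, -B). *)
  have h := H C (- B); have : 0 <= C * (A * C - B ^+ 2) by nra.
  by rewrite pmulr_rge0// subr_ge0.
have [->|B0] := eqVneq B 0; first by rewrite expr0n mulr_ge0.
(* With C = 0 the form at (1, t) is A + 2 t B, so a suitable t makes it
   negative if B is not 0. *)
have := H 1 (- (1 + A) / B).
rewrite mulr1 -mulrA divfK// C00 mulr0; nra.
Qed.

Lemma Rintegral_ae_eq f g : intble f -> measurable_fun D g ->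
  {ae mu, forall x, D x -> f x = g x} ->
  \int[mu]_(x in D) f x = \int[mu]_(x in D) g x.
Proof.
move=> If mg fg; congr fine; apply: ae_eq_integral => //.
- exact: measurable_int If.
- exact/measurable_EFinP.
- by apply: filterS fg => x /= h Dx; rewrite h.
Qed.

(** Convergence in L^2 implies weak convergence. *)
Lemma Rintegral_cvg_sqint h (c : nat -> T -> R) c0 : sqint h ->
  (forall n, sqint (c n)) -> sqint c0 ->
  \int[mu]_(x in D) ((c n x - c0 x) ^+ 2) @[n --> \oo] --> (0 : R) ->
  \int[mu]_(x in D) (h x * c n x) @[n --> \oo] --> \int[mu]_(x in D) (h x * c0 x).
Proof.
move=> Sh Sc Sc0 cv.
have E n : \int[mu]_(x in D) (h x * (c n x - c0 x)) =
   \int[mu]_(x in D) (h x * c n x) - \int[mu]_(x in D) (h x * c0 x).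
  rewrite -RintegralB//; try exact: sqintM.
  by apply: eq_Rintegral => x _; rewrite mulrBr.
have {}E : forall n, `|\int[mu]_(x in D) (h x * c0 x) - \int[mu]_(x in D) (h x * c n x)| <=
   Num.sqrt (\int[mu]_(x in D) (h x ^+ 2) * \int[mu]_(x in D) ((c n x - c0 x) ^+ 2)).
  move=> n; rewrite distrC -E -sqrtr_sqr ler_wsqrtr//.
  by apply: Rintegral_CauchySchwarz => //; exact: sqintB.
have cv0 : Num.sqrt (\int[mu]_(x in D) (h x ^+ 2) *
    \int[mu]_(x in D) ((c n x - c0 x) ^+ 2)) @[n --> \oo] --> (0 : R).
  rewrite -[X in _ --> X](sqrtr0 R) -[X in Num.sqrt X](mulr0 (\int[mu]_(x in D) (h x ^+ 2))).
  apply: continuous_cvg; first exact: sqrt_continuous.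
  by apply: cvgM => //; exact: cvg_cst.
apply/cvgrPdist_le => e e0.
have /cvgrPdist_le/(_ _ e0) := cv0; apply: filterS => n.
rewrite sub0r normrN => le_e; apply: (le_trans (E n)).
by apply: le_trans le_e; rewrite ler_norm.
Qed.

End SquareIntegrable.

Section MoreSquareIntegrable.
Context d (T : measurableType d) (R : realType).
Variables (mu : {measure set T -> \bar R}) (D : set T).
Hypothesis mD : measurable D.
Implicit Types f g h : T -> R.
Local Notation S f := (sqint mu D f).

Definition L2cvg (c : nat -> T -> R) f :=
  \int[mu]_(x in D) ((c n x - f x) ^+ 2) @[n --> \oo] --> (0 : R).

(** The squared distance is controlled by [(x + y)^2 <= 2 x^2 + 2 y^2]. *)
Lemma L2cvg_linear a c f c' f' : (forall n, S (c n)) -> S f ->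
  (forall n, S (c' n)) -> S f' -> L2cvg c f -> L2cvg c' f' ->
  L2cvg (fun n x => a * c n x + c' n x) (fun x => a * f x + f' x).
Proof.
move=> Sc Sf Sc' Sf' cf cf'.
apply: (@squeeze_cvgr _ _ _ _ (cst 0) (fun n => (2 * a ^+ 2) *
   \int[mu]_(x in D) ((c n x - f x) ^+ 2) + 2 * \int[mu]_(x in D) ((c' n x - f' x) ^+ 2))).
- apply: nearW => n; rewrite Rintegral_ge0 /=; last by move=> x _; exact: sqr_ge0.
  have Sd := sqintB mD (Sc n) Sf; have Sd' := sqintB mD (Sc' n) Sf'.
  rewrite -!RintegralZl//; [|exact: Sd'.2|exact: Sd.2].
  rewrite -RintegralD//; last 2 first.
  + exact: (intbleZ mD (2 * a ^+ 2) Sd.2).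
  + exact: (intbleZ mD 2 Sd'.2).
  apply: le_Rintegral => //.
  + have := sqintB mD (sqintD mD (sqintZ mD a (Sc n)) (Sc' n))
      (sqintD mD (sqintZ mD a Sf) Sf'); by case.
  + apply: (intbleD mD); [exact: (intbleZ mD (2 * a ^+ 2) Sd.2)|exact: (intbleZ mD 2 Sd'.2)].
  + move=> x _; have := sqr_ge0 (a * (c n x - f x) - (c' n x - f' x)).
    set X := c n x; set Y := f x; set Z := c' n x; set W := f' x; nra.
- exact: cvg_cst.
- rewrite -[X in _ --> X](_ : 2 * a ^+ 2 * 0 + 2 * 0 = 0); last by rewrite !mulr0 addr0.
  by apply: cvgD; apply: cvgM => //; exact: cvg_cst.
Qed.

(** Expanding [c_n^2] around f leaves only a pairing with f, which converges
    weakly. *)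
Lemma L2cvg_Rintegral_sqr c f : (forall n, S (c n)) -> S f -> L2cvg c f ->
  \int[mu]_(x in D) (c n x ^+ 2) @[n --> \oo] --> \int[mu]_(x in D) (f x ^+ 2).
Proof.
move=> Sc Sf cf.
have fc := Rintegral_cvg_sqint mD Sf Sc Sf cf.
have E n : \int[mu]_(x in D) (c n x ^+ 2) = 1 * \int[mu]_(x in D) ((c n x - f x) ^+ 2)
    + 2 * \int[mu]_(x in D) (f x * c n x) + (-1) * \int[mu]_(x in D) (f x ^+ 2).
  rewrite -Rintegral_lin3//.
  - by apply: eq_Rintegral => x _; ring.
  - exact: (sqintB mD (Sc n) Sf).2.
  - exact: sqintM.
  - exact: Sf.2.
rewrite (_ : (fun n => _) = (fun n => 1 * \int[mu]_(x in D) ((c n x - f x) ^+ 2)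
    + 2 * \int[mu]_(x in D) (f x * c n x) + (-1) * \int[mu]_(x in D) (f x ^+ 2))); last first.
  by apply/funext => n; exact: E.
rewrite [X in _ --> X](_ : _ = 1 * 0 + 2 * \int[mu]_(x in D) (f x * f x) +
   (-1) * \int[mu]_(x in D) (f x ^+ 2)); last first.
  rewrite (_ : \int[mu]_(x in D) (f x * f x) = \int[mu]_(x in D) (f x ^+ 2)).
    ring.
  by apply: eq_Rintegral => x _; rewrite expr2.
apply: cvgD; last exact: cvg_cst.
by apply: cvgD; apply: cvgM => //; exact: cvg_cst.
Qed.

Lemma sqint_norm f : S f -> S (fun x => `|f x|).
Proof.
move=> [mf f2]; split; first exact: measurableT_comp.
by move: f2; congr (mu.-integrable D _); apply/funext => x /=; rewrite real_normK ?num_real.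
Qed.

Lemma sqint_bounded f g (C : R) : measurable_fun D g -> (forall x, `|g x| <= C) ->
  S f -> S (fun x => f x * g x).
Proof.
move=> mg gC [mf f2]; split; first exact: measurable_funM.
apply: (le_intble mD _ _ (intbleZ mD (C ^+ 2) f2)).
  by apply: measurable_funX; exact: measurable_funM.
move=> x _; rewrite normrX normrM exprMn mulrC !real_normK ?num_real//.
apply: ler_wpM2r; rewrite ?sqr_ge0// -(real_normK (num_real (g x))).
by rewrite lerXn2r ?nnegrE// (le_trans _ (gC x)).
Qed.

(** The fourth power of f is integrable, in the form that lets the L^2 lemmas
    apply to [f^2]. *)
Definition quadint f := S (fun x => f x ^+ 2).

Lemma sqint_mul f g : measurable_fun D f -> measurable_fun D g ->
  quadint f -> quadint g -> S (fun x => f x * g x).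
Proof.
move=> mf mg f4 g4; split; first exact: measurable_funM.
have := sqintM mD f4 g4; congr (mu.-integrable D _).
by apply/funext => x /=; rewrite exprMn.
Qed.

End MoreSquareIntegrable.

(** * Fourth powers in the limit *)

Section LimitL4.
Context d (T : measurableType d) (R : realType).
Variables (mu : {measure set T -> \bar R}) (D : set T).
Hypothesis mD : measurable D.
Local Notation S f := (sqint mu D f).

(** On the nonnegative reals [s |-> min(s, M)^2] is nondecreasing and
    2M-Lipschitz, and it is at most [s^2]. *)
Lemma sqr_minr_le (s t M : R) : 0 <= s -> 0 <= t -> 0 <= M ->
  Num.min s M ^+ 2 <= t ^+ 2 + 2 * M * `|s - t|.
Proof.
move=> s0 t0 M0; have st := ler_norm (s - t); have n0 := normr_ge0 (s - t).
have [sM|Ms] := leP s M; last first.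
  have [tM|/ltW Mt] := leP t M; last by nra.
  have : M - t <= `|s - t| by lra.
  by nra.
have [ts|/ltW st'] := leP t s; last by nra.
by nra.
Qed.

Lemma ge_of_cvg (e : nat -> R) (a b : R) :
  e n @[n --> \oo] --> b -> (forall n, a <= e n) -> a <= b.
Proof.
move=> eb ae; rewrite -(cvg_lim _ eb)//; apply: limr_ge.
  by apply/cvg_ex; exists b.
exact: nearW.
Qed.

(** Lower semicontinuity of the L^4 norm under L^2 convergence. The truncated
    integrand [min(q^2, M)^2] exceeds [c_n^4] by at most [2 M |q^2 - c_n^2|],
    whose integral tends to 0 for each fixed M because c_n tends to q in L^2;
    so its integral is at most b, and monotone convergence in M removes the
    truncation. No almost everywhere convergent subsequence is extracted. *)
Lemma quadint_limit (c : nat -> T -> R) (q : T -> R) (B : nat -> R) (b : R) :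
  (forall n, S (c n)) -> S q -> L2cvg mu D c q ->
  (forall n, quadint mu D (c n)) ->
  (forall n, \int[mu]_(x in D) (c n x ^+ 4) <= B n) -> B n @[n --> \oo] --> b ->
  quadint mu D q /\ \int[mu]_(x in D) (q x ^+ 4) <= b.
Proof.
move=> Sc Sq cq c4 cB Bb.
have mq := Sq.1.
have Snq := sqint_norm Sq.
have Sd n : S (fun x => `|c n x - q x|) by apply: sqint_norm => //; exact: sqintB.
have d0 : \int[mu]_(x in D) (`|q x| * `|c n x - q x|) @[n --> \oo] --> (0 : R).
  have := @Rintegral_cvg_sqint _ _ _ mu D mD (fun x => `|q x|)
    (fun n x => `|c n x - q x|) (cst 0) Snq Sd.
  have S0 : S (cst 0).
    split; first exact: measurable_cst.
    rewrite (_ : _ \o _ = cst 0%E); first exact: integrable0.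
    by apply/funext => x /=; rewrite expr0n.
  move=> /(_ S0); rewrite (_ : \int[mu]_(x in D) (`|q x| * cst 0 x) = 0); last first.
    by under eq_Rintegral do rewrite /= mulr0; rewrite Rintegral_cst// mul0r.
  apply; rewrite (_ : (fun n => _) = (fun n => \int[mu]_(x in D) ((c n x - q x) ^+ 2)))//.
  by apply/funext => n; apply: eq_Rintegral => x _; rewrite subr0 real_normK ?num_real.
(* Square-integrable truncations of q^4. *)
pose t (M : nat) x := Num.min (q x ^+ 2) M%:R ^+ 2.
have mt M : measurable_fun D (t M).
  apply: measurable_funX; apply: measurable_minr; last exact: measurable_cst.
  exact: measurable_funX.
have t0 M x : 0 <= t M x by exact: sqr_ge0.
have It M : mu.-integrable D (EFin \o t M).
  apply: (le_intble mD (mt M) _ (intbleZ mD M%:R Sq.2)) => x _.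
  rewrite ger0_norm// /t expr2; apply: ler_pM; rewrite ?le_min ?sqr_ge0 ?ler0n//.
    by rewrite ge_min lexx orbT.
  by rewrite ge_min lexx.
have tb M : \int[mu]_(x in D) t M x <= b.
  pose e n := B n + (2 * M%:R) * (\int[mu]_(x in D) ((c n x - q x) ^+ 2) +
     2 * \int[mu]_(x in D) (`|q x| * `|c n x - q x|)).
  have eb : e n @[n --> \oo] --> b.
    rewrite -[X in _ --> X](_ : b + (2 * M%:R) * (0 + 2 * 0) = b);
      last by rewrite !(mulr0, addr0).
    apply: cvgD => //; apply: cvgM; first exact: cvg_cst.
    by apply: cvgD => //; apply: cvgM => //; exact: cvg_cst.
  apply: (ge_of_cvg eb) => n.
  apply: le_trans (_ : _ <= \int[mu]_(x in D) (c n x ^+ 4) +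
     2 * M%:R * (\int[mu]_(x in D) ((c n x - q x) ^+ 2) +
     2 * \int[mu]_(x in D) (`|q x| * `|c n x - q x|))) _; last by rewrite lerD2r.
  have Ic4 : mu.-integrable D (EFin \o (fun x => c n x ^+ 4)).
    by have := (c4 n).2; congr (mu.-integrable D _); apply/funext => x /=; rewrite -exprM.
  have Id2 := (sqintB mD (Sc n) Sq).2; have Iqd := sqintM mD Snq (Sd n).
  rewrite mulrDr addrA mulrA -[X in _ <= X + _ + _]mul1r -Rintegral_lin3//.
  apply: le_Rintegral => //.
    apply: (intbleD mD); last exact: intbleZ.
    by apply: (intbleD mD); exact: intbleZ.
  move=> x _; rewrite mul1r.
  have min_le := @sqr_minr_le (q x ^+ 2) (c n x ^+ 2) M%:R (sqr_ge0 _) (sqr_ge0 _) (ler0n _ _).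
  have dist_le : `|q x ^+ 2 - c n x ^+ 2| <=
      (c n x - q x) ^+ 2 + 2 * (`|q x| * `|c n x - q x|).
    rewrite -[(_ - _) ^+ 2]real_normK ?num_real// distrC.
    have -> : c n x ^+ 2 - q x ^+ 2 = (c n x - q x) * (2 * q x + (c n x - q x)) by ring.
    rewrite normrM; have := ler_normD (2 * q x) (c n x - q x).
    rewrite normrM ger0_norm//; have := normr_ge0 (c n x - q x).
    set X := `|c n x - q x|; set Y := `|q x|; set Z := `|_ + _|; nra.
  have M0 : 0 <= 2 * M%:R :> R by rewrite mulr_ge0.
  have := ler_wpM2l M0 dist_le; rewrite -exprM in min_le; rewrite /t.
  by move: min_le; lra.
have lim4 : (\int[mu]_(x in D) (q x ^+ 4)%:E <= b%:E)%E.
  have mtE M : measurable_fun D (fun x => (t M x)%:E) by exact/measurable_EFinP.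
  have t0E M x : D x -> (0 <= (t M x)%:E)%E by rewrite lee_fin.
  have ndt x : D x -> nondecreasing_seq (fun M => (t M x)%:E).
    move=> _ M1 M2 M12; rewrite lee_fin /t lerXn2r ?nnegrE ?le_min ?sqr_ge0 ?ler0n//.
    by rewrite !ge_min lexx ler_nat M12 orbT.
  have cvt := @cvg_monotone_convergence _ _ _ mu D mD _ mtE t0E ndt.
  rewrite (eq_integral (fun x => limn (fun M => (t M x)%:E))).
    rewrite -(cvg_lim _ cvt)//; apply: lime_le; first by apply/cvg_ex; eexists; exact: cvt.
    apply: nearW => M; rewrite -[leLHS]fineK ?lee_fin; first exact: tb.
    exact: (integrable_fin_num mD (It M)).
  move=> x _; apply/esym/cvg_lim => //; apply: cvg_near_cst.
  near=> M; rewrite /t min_l -?exprM//.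
  near: M; exact: nbhs_infty_ger.
have q40 : (0 <= \int[mu]_(x in D) (q x ^+ 4)%:E)%E.
  by apply: integral_ge0 => x _; rewrite lee_fin exprn_even_ge0.
have q4y : (\int[mu]_(x in D) (q x ^+ 4)%:E < +oo)%E by exact: le_lt_trans (ltry b).
split; last by rewrite -lee_fin fineK// ge0_fin_numE.
split; first exact: measurable_funX.
apply/integrableP; split; first by apply/measurable_EFinP; do 2 apply: measurable_funX.
apply: le_lt_trans q4y; rewrite le_eqVlt; apply/orP; left; apply/eqP.
by apply: eq_integral => x _; rewrite /= ger0_norm ?sqr_ge0// -exprM.
Unshelve. all: by end_near.
Qed.

End LimitL4.

(** * Test functions on the three-dimensional space *)

Section Space.
Context {R : realType}.
Local Notation T := (R3 R).
Local Notation mu := (@mu3 R).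
Implicit Types (f g h phi psi : T -> R) (i : 'I_3) (K : set T).

(** An open set is the union of the boxes with rational vertices that it
    contains, and there are countably many of these. *)
Lemma open_measurable3 (U : set T) : open U -> measurable U.
Proof.
move=> oU.
pose box (q : (rat * rat) * (rat * rat) * (rat * rat)) : set T :=
  ((`]ratr q.1.1.1, ratr q.1.1.2[ `*` `]ratr q.1.2.1, ratr q.1.2.2[) `*`
    `]ratr q.2.1, ratr q.2.2[)%classic.
have -> : U = \bigcup_q (if `[< box q `<=` U >] then box q else set0).
  apply/seteqP; split => [x Ux|x [q _]]; last by case: asboolP => // qU /qU.
  have /nbhs_ballP[e /= e0 eU] : nbhs x U by exact: open_nbhs_nbhs.
  (* A rational interval around each coordinate, inside the ball. *)
  have side (y : R) : exists p : rat * rat,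
      (y \in `]ratr p.1, ratr p.2[) /\ ([set` `]ratr p.1, ratr p.2[] `<=` ball y e).
    have [a ya] : exists a : rat, ratr a \in `]y - e, y[.
      by apply: rat_in_itvoo; rewrite ltrBlDr ltrDl.
    have [b yb] : exists b : rat, ratr b \in `]y, y + e[.
      by apply: rat_in_itvoo; rewrite ltrDl.
    move: ya yb; rewrite !in_itv /= => /andP[ya1 ya2] /andP[yb1 yb2].
    exists (a, b); split; first by rewrite in_itv /= ya2.
    move=> z /=; rewrite in_itv /= => /andP[az zb].
    by rewrite /ball /= ltr_distlC (lt_trans ya1 az) (lt_trans zb yb2).
  have [p1 [x1 U1]] := side x.1.1; have [p2 [x2 U2]] := side x.1.2.
  have [p3 [x3 U3]] := side x.2.
  exists (p1, p2, p3) => //; case: asboolP => [_|]; first by split => //; split.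
  by case=> y [[y1 y2] y3]; apply: eU; split; [split; [exact: U1|exact: U2]|exact: U3].
apply: countable_bigcupT_measurable => // q; case: ifP => _ //.
by apply: measurableX => //; exact: measurableX.
Qed.

Lemma continuous_measurable3 f : continuous f -> measurable_fun setT f.
Proof.
move=> /continuousP cf; apply: (measurability _ (RGenOpens.measurableE R)).
move=> _ [_ [a [b ->] <-]]; rewrite setTI; apply: open_measurable3.
exact/cf/interval_open.
Qed.

Definition cube (M : R) : set T :=
  ([set` `[- M, M]] `*` [set` `[- M, M]]) `*` [set` `[- M, M]].

Lemma measurable_cube M : measurable (cube M).
Proof. by apply: measurableX => //; exact: measurableX. Qed.

Lemma compact_sub_cube K : compact K -> exists2 M : R, 0 < M & K `<=` cube M.
Proof.
move=> /compact_bounded[M0 [_ KM]].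
exists (`|M0| + 1) => [|x Kx]; first by rewrite ltr_wpDl.
have := KM (`|M0| + 1); rewrite (le_lt_trans (ler_norm _)) ?ltrDl// => /(_ isT).
move=> /(_ _ Kx) /=; rewrite /Num.norm /= !ge_max => /andP[/andP[x1 x2] x3].
by do ?split; rewrite /= in_itv /= -ler_norml.
Qed.

Lemma mu3_cube_lty (M : R) : (mu (cube M) < +oo)%E.
Proof.
have mI : measurable ([set` `[- M, M]] : set (measurableTypeR R)) by [].
have E2 := product_measure1E (@lebesgue_measure R) (@lebesgue_measure R) mI mI.
have E3 := product_measure1E (@lebesgue_measure R \x @lebesgue_measure R)%E
  (@lebesgue_measure R) (measurableX mI mI) mI.
have L : (@lebesgue_measure R [set` `[- M, M]%R] < +oo)%E.
  by rewrite lebesgue_measure_itv /=; case: ifPn => // _; rewrite ltry.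
rewrite /mu3 /cube [ltLHS]E3 [X in (X * _ < _)%E]E2.
by rewrite !lte_mul_pinfty ?mule_ge0 ?fin_numM ?ge0_fin_numE.
Qed.

Lemma compact_support_bounded K g : compact K -> continuous g ->
  (forall x, ~ K x -> g x = 0) -> exists C, forall x, `|g x| <= C.
Proof.
move=> cK cg g0.
have /compact_bounded[C [_ gC]] : compact (g @` K).
  by apply: continuous_compact => //; exact: continuous_subspaceT.
exists (`|C| + 1) => x.
have [Kx|nKx] := pselect (K x); last by rewrite g0// normr0 addr_ge0.
apply: (gC (`|C| + 1)); last by exists x.
by rewrite (le_lt_trans (ler_norm _))// ltrDl.
Qed.

(** Such a function is bounded and vanishes outside a cube of finite measure. *)
Lemma compact_support_sqint K g : compact K -> continuous g ->
  (forall x, ~ K x -> g x = 0) -> sqint mu setT g.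
Proof.
move=> cK cg g0; split; first exact: continuous_measurable3.
have [M M0 KM] := compact_sub_cube cK.
have mB := measurable_cube M.
rewrite (_ : _ \o _ = (EFin \o (fun x => g x ^+ 2)) \_ (cube M)); last first.
  apply/funext => x /=; rewrite patchE; case: ifPn => //.
  rewrite notin_setE => xM; rewrite g0 ?expr0n// => /KM; exact.
apply/(integrable_mkcond (EFin \o (fun x => g x ^+ 2)) mB).
apply: measurable_bounded_integrable => //.
- exact: mu3_cube_lty.
- by apply: measurable_funX; apply: measurable_funTS; exact: continuous_measurable3.
have [C gC] := compact_support_bounded cK cg g0.
exists (C ^+ 2); split; first exact: num_real.
move=> y Cy x _; apply: le_trans (ltW Cy).
by rewrite normrX lerXn2r ?nnegrE// (le_trans _ (gC x)).
Qed.

Lemma partialD i f g x : derivable f x (basis3 i) -> derivable g x (basis3 i) ->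
  partial i (fun x => f x + g x) x = partial i f x + partial i g x.
Proof. by move=> df dg; rewrite /partial -deriveD. Qed.

Lemma partialZ i a f x : derivable f x (basis3 i) ->
  partial i (fun x => a * f x) x = a * partial i f x.
Proof. by move=> df; rewrite /partial -[RHS]/(a *: 'D_(basis3 i) f x) -deriveZ. Qed.

Lemma partialM i f g x : derivable f x (basis3 i) -> derivable g x (basis3 i) ->
  partial i (fun x => f x * g x) x = f x * partial i g x + g x * partial i f x.
Proof. by move=> df dg; exact: (deriveM df dg). Qed.

(** Closedness of K makes f vanish near every point outside K. *)
Lemma partial_out i f K x : closed K -> (forall x, ~ K x -> f x = 0) -> ~ K x ->
  partial i f x = 0.
Proof.
move=> cK f0 nKx; rewrite /partial (@near_eq_derive _ _ _ f (cst 0)).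
  by rewrite derive_cst.
have : nbhs x (~` K) by apply: open_nbhs_nbhs; split => //; exact: closed_openC.
by apply: filterS => y; exact: f0.
Qed.

(** A form of smoothness that takes the first derivative first, so that
    stability under products follows by induction on the order: each partial
    derivative of a product is a sum of products of functions with one order of
    differentiability less. *)
Fixpoint differentiable_upto n f : Prop :=
  [/\ continuous f, forall i x, derivable f x (basis3 i) &
   if n is m.+1 then forall i, differentiable_upto m (partial i f) else True].

Lemma smoothP f : smooth f <-> forall n, differentiable_upto n f.
Proof.
split=> [sf n|df].
  elim: n f sf => [|n IH] f sf; split; try exact: (sf [::]).1; try exact: (sf [::]).2.
    by [].
  move=> i; apply: IH => s; have := sf (rcons s i).
  by rewrite foldr_rcons.
move=> s; have := df (size s) => {df}.
elim/last_ind: s f => [|s i IH] f; first by case.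
by rewrite size_rcons foldr_rcons => -[_ _ /(_ i)]; exact: IH.
Qed.

Lemma differentiable_upto_linear n a f g : differentiable_upto n f ->
  differentiable_upto n g -> differentiable_upto n (fun x => a * f x + g x).
Proof.
elim: n f g => [|n IH] f g [cf df If] [cg dg Ig].
all: have dL : forall i x, derivable (fun x => a * f x + g x) x (basis3 i)
  by move=> i x; apply: derivableD => //; exact: derivableZ.
all: have cL : continuous (fun x => a * f x + g x)
  by move=> x; apply: cvgD; [apply: cvgM; [exact: cvg_cst|exact: cf]|exact: cg].
  by split.
split => // i.
rewrite (_ : partial i _ = fun x => a * partial i f x + partial i g x).
  exact: IH (If i) (Ig i).
apply/funext => x; rewrite partialD//; last exact: derivableZ.
by rewrite partialZ.
Qed.

Lemma differentiable_uptoW n f : differentiable_upto n.+1 f -> differentiable_upto n f.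
Proof.
elim: n f => [|n IH] f; first by case.
by case=> cf df If; split => // i; exact: IH.
Qed.

Lemma differentiable_upto_mul n f g : differentiable_upto n f ->
  differentiable_upto n g -> differentiable_upto n (fun x => f x * g x).
Proof.
elim: n f g => [|n IH] f g Hf Hg; have [cf df If] := Hf; have [cg dg Ig] := Hg.
all: have dL : forall i x, derivable (fun x => f x * g x) x (basis3 i)
  by move=> i x; exact: derivableM.
all: have cL : continuous (fun x => f x * g x)
  by move=> x; apply: cvgM; [exact: cf|exact: cg].
  by split.
split => // i.
rewrite (_ : partial i _ = fun x => 1 * (f x * partial i g x) + g x * partial i f x).
  apply: differentiable_upto_linear.
    exact: IH (differentiable_uptoW Hf) (Ig i).
  exact: IH (differentiable_uptoW Hg) (If i).
by apply/funext => x; rewrite partialM// mul1r.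
Qed.

Lemma test_function_linear Omega a f g : test_function Omega f ->
  test_function Omega g -> test_function Omega (fun x => a * f x + g x).
Proof.
move=> [sf cf fO] [sg cg gO].
have sub : closure [set x | a * f x + g x != 0] `<=`
    closure [set x | f x != 0] `|` closure [set x | g x != 0].
  rewrite -closureU; apply: closureS => x /=.
  have [->|] := eqVneq (f x) 0; last by left.
  by rewrite mulr0 add0r; right.
split; last by move=> x /sub[/fO|/gO].
- apply/smoothP => n;
  exact: differentiable_upto_linear ((smoothP f).1 sf n) ((smoothP g).1 sg n).
- apply: (subclosed_compact _ _ sub); first exact: closed_closure.
  exact: compactU.
Qed.

Lemma test_functionM Omega f g : test_function Omega f ->
  test_function Omega g -> test_function Omega (fun x => f x * g x).
Proof.
move=> [sf cf fO] [sg cg gO].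
have sub : closure [set x | f x * g x != 0] `<=` closure [set x | f x != 0].
  by apply: closureS => x /=; rewrite mulf_eq0 negb_or => /andP[].
split; last by move=> x /sub/fO.
- by apply/smoothP => n;
  exact: differentiable_upto_mul ((smoothP f).1 sf n) ((smoothP g).1 sg n).
- by apply: (subclosed_compact _ _ sub) => //; exact: closed_closure.
Qed.

(** C^1 functions vanishing outside the compact set K. *)
Definition C1c K f := [/\ compact K, closed K, continuous f,
  (forall i x, derivable f x (basis3 i)) /\ (forall i, continuous (partial i f)) &
  forall x, ~ K x -> f x = 0].

Lemma test_function_C1c Omega f : test_function Omega f ->
  exists2 K, K `<=` Omega & C1c K f.
Proof.
move=> [sf cf fO]; exists (closure [set x | f x != 0]) => //; split => //.
- exact: closed_closure.
- exact: (sf [::]).1.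
- split; first exact: (sf [::]).2.
  by move=> i; exact: (sf [:: i]).1.
- move=> x; apply: contra_notP => /eqP fx; exact: subset_closure.
Qed.

Lemma C1c_sqint K f : C1c K f -> sqint mu setT f.
Proof. by move=> [cK _ cf _ f0]; exact: compact_support_sqint f0. Qed.

Lemma C1c_sqint_partial K f i : C1c K f -> sqint mu setT (partial i f).
Proof.
move=> [cK clK cf [_ cdf] f0]; apply: compact_support_sqint cK _ _ => // x.
exact: partial_out f0.
Qed.

End Space.

(** * Iterated integrals *)

Section SigmaFiniteProduct.
Local Open Scope ereal_scope.
Context d1 d2 (T1 : measurableType d1) (T2 : measurableType d2) (R : realType).
Variables (m1 : {sigma_finite_measure set T1 -> \bar R})
  (m2 : {sigma_finite_measure set T2 -> \bar R}).

(** The measure [m1 \x m2], under a name that carries its sigma-finiteness, so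
    that iterated products can be disintegrated one factor at a time. *)
Definition sigma_product : set (T1 * T2) -> \bar R := m1 \x m2.

HB.instance Definition _ := Measure.on sigma_product.

Let sigma_product_sigma_finite : sigma_finite setT sigma_product.
Proof.
have /sigma_finiteP[F [TF ndF Ffin]] := sigma_finiteT m1.
have /sigma_finiteP[G [TG ndG Gfin]] := sigma_finiteT m2.
exists (fun n => F n `*` G n).
  rewrite -setXTT TF TG; apply/seteqP; split=> [[x y] [/= [n _ Fx] [k _ Gy]]|].
    exists (maxn n k) => //; split.
      by move: x Fx; exact/subsetPset/ndF/leq_maxl.
    by move: y Gy; exact/subsetPset/ndG/leq_maxr.
  by move=> [x y] [n _ [/= Fx Gy]]; split; exists n.
move=> n; have [mF Fn] := Ffin n; have [mG Gn] := Gfin n.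
split; first exact: measurableX.
by rewrite [ltLHS]product_measure1E// lte_mul_pinfty// ge0_fin_numE.
Qed.

HB.instance Definition _ := Measure_isSigmaFinite.Build _ _ _ sigma_product
  sigma_product_sigma_finite.

Variable g : T1 * T2 -> \bar R.
Hypotheses (mg : measurable_fun setT g) (g0 : forall w, 0 <= g w).

Lemma tonelli_inner_fst :
  \int[sigma_product]_w g w = \int[m2]_y \int[m1]_x g (x, y).
Proof. exact: (fubini_tonelli2 g). Qed.

Lemma tonelli_inner_snd :
  \int[sigma_product]_w g w = \int[m1]_x \int[m2]_y g (x, y).
Proof. exact: (fubini_tonelli1 g). Qed.

Lemma measurable_integral_fst : measurable_fun setT (fun y => \int[m1]_x g (x, y)).
Proof. exact: (measurable_fun_fubini_tonelli_G g). Qed.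

Lemma measurable_integral_snd : measurable_fun setT (fun x => \int[m2]_y g (x, y)).
Proof. exact: (measurable_fun_fubini_tonelli_F g). Qed.

End SigmaFiniteProduct.

Section ProductIntegrals.
Local Open Scope ereal_scope.

(** Both sides may be infinite here: along slices, the integrals on the right
    need not be known to be finite. *)
Lemma integral_CauchySchwarz d (T : measurableType d) (R : realType)
    (mu : {measure set T -> \bar R}) (f g : T -> R) :
  measurable_fun setT f -> measurable_fun setT g ->
  (\int[mu]_x `|f x * g x|%:E) * (\int[mu]_x `|f x * g x|%:E) <=
  (\int[mu]_x (f x ^+ 2)%:E) * (\int[mu]_x (g x ^+ 2)%:E).
Proof.
move=> mf mg.
have sq (h : T -> R) : Lnorm mu 2%:E (EFin \o h) * Lnorm mu 2%:E (EFin \o h) =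
    \int[mu]_x (h x ^+ 2)%:E.
  have E : \int[mu]_x `|(EFin \o h) x| `^ 2 = \int[mu]_x (h x ^+ 2)%:E.
    by apply: eq_integral => x _; rewrite /= powR_mulrn// real_normK ?num_real.
  rewrite unlock E -poweRD ?add_neq0_poweRD_def//.
  have -> : (2^-1 + 2^-1 = 1 :> R)%R by lra.
  by rewrite poweRe1// integral_ge0// => x _; rewrite lee_fin sqr_ge0.
have two : (0 < 2 :> R)%R by [].
have := @hoelder _ _ _ mu f g 2 2 mf mg two two.
rewrite -[(2^-1)%R in LHS]mul1r -splitr => /(_ erefl); rewrite Lnorm1.
set I := (X in X <= _); rewrite -/I => le_I.
rewrite -!sq muleACA; apply: lee_pmul => //; exact: integral_ge0.
Qed.

(** The reason for bounding [phi^4] on a plane by one function of each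
    coordinate: the double integral of the bound factors. *)
Lemma integral_prod_le d1 d2 (T1 : measurableType d1) (T2 : measurableType d2)
    (R : realType) (m1 : {sigma_finite_measure set T1 -> \bar R})
    (m2 : {sigma_finite_measure set T2 -> \bar R}) (F : T1 * T2 -> \bar R)
    (a : T2 -> \bar R) (b : T1 -> \bar R) :
  measurable_fun setT F -> (forall z, 0 <= F z) ->
  measurable_fun setT a -> (forall y, 0 <= a y) ->
  measurable_fun setT b -> (forall x, 0 <= b x) ->
  (forall x y, F (x, y) <= a y * b x) ->
  \int[sigma_product m1 m2]_z F z <= (\int[m2]_y a y) * (\int[m1]_x b x).
Proof.
move=> mF F0 ma a0 mb b0 Fab.
rewrite (tonelli_inner_snd _ _ mF F0) -ge0_integralZl//; last exact: integral_ge0.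
apply: ge0_le_integral => //.
- by move=> x _; exact: integral_ge0.
- exact: measurable_integral_snd.
- exact: measurable_funeM.
move=> x _; rewrite -ge0_integralZr//; apply: ge0_le_integral => //.
- by apply: measurableT_comp => //; exact: pair1_measurable.
- exact: emeasurable_funM.
Qed.

End ProductIntegrals.

Section Slices.
Context {R : realType}.
Local Notation leb := (@lebesgue_measure R).
Implicit Types (h : R -> R) (M : R).

(** [h(x)^2] is the integral of [2 h h'] from a point to the left of the support
    of h up to x. *)
Lemma sqr_le_integral_deriv h M : (forall x, derivable h x 1) ->
  continuous (fun x => 'D_1 h x) -> (forall x, M < `|x| -> h x = 0) ->
  forall x, ((h x ^+ 2)%:E <= \int[leb]_t (`|2 * h t * 'D_1 h t|)%:E)%E.
Proof.
move=> dh ch' h0 x.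
have ch : continuous h.
  by move=> y; apply/differentiable_continuous/derivable1_diffP.
have cf : continuous (fun t => 2 * h t * 'D_1 h t).
  by move=> t; apply: cvgM; [apply: cvgM; [exact: cvg_cst|exact: ch]|exact: ch'].
(* A point to the left of both x and the support of h. *)
pose a : R := - (`|M| + `|x| + 1).
have ax : a < x.
  by rewrite /a ltrNl; have := ler_norm (- x); have := normr_ge0 M; rewrite normrN; lra.
have ha : h a = 0.
  apply: h0; rewrite /a normrN ger0_norm ?addr_ge0//.
  by have := ler_norm M; have := normr_ge0 x; lra.
have d2 t : derivable (fun t => h t ^+ 2) t 1 /\
    'D_1 (fun t => h t ^+ 2) t = 2 * h t * 'D_1 h t.
  split; first exact: (derivableM (dh t) (dh t)).
  rewrite [LHS](deriveM (dh t) (dh t)) -[_ *: _]/(h t * 'D_1 h t); ring.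
have FTC : (\int[leb]_(t in `[a, x]) (2 * h t * 'D_1 h t)%:E = (h x ^+ 2)%:E)%E.
  rewrite (@continuous_FTC2 _ _ (fun t => h t ^+ 2))//.
  - by rewrite ha -EFinB expr0n subr0.
  - exact: continuous_subspaceT.
  - have c2 : continuous (fun t => h t ^+ 2).
      by move=> t; apply: cvgM; exact: ch.
    split; first by move=> t _; exact: (d2 t).1.
    + exact/cvg_at_right_filter/c2.
    + exact/cvg_at_left_filter/c2.
  - by move=> t _; rewrite derive1E; exact: (d2 t).2.
rewrite -FTC; apply: (@le_trans _ _ (\int[leb]_(t in `[a, x]) (`|2 * h t * 'D_1 h t|)%:E)%E).
  apply: le_trans (lee_abs _) _; apply: le_abse_integral => //.
  by apply/measurable_EFinP/measurable_funTS; exact: continuous_measurable_fun.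
apply: ge0_subset_integral => //.
apply/measurable_EFinP; apply: measurableT_comp => //.
exact: continuous_measurable_fun.
Qed.

End Slices.

Section SliceEstimate.
Local Open Scope ereal_scope.
Context d1 d2 d3 (T1 : measurableType d1) (T2 : measurableType d2)
  (T3 : measurableType d3) (R : realType).
Variables (m1 : {sigma_finite_measure set T1 -> \bar R})
  (m2 : {sigma_finite_measure set T2 -> \bar R})
  (m3 : {sigma_finite_measure set T3 -> \bar R}).
Local Notation m12 := (sigma_product m1 m2).
Local Notation m123 := (sigma_product m12 m3).
Variables f g1 g2 g3 : T1 * T2 * T3 -> R.
Hypotheses (mf : measurable_fun setT f) (mg1 : measurable_fun setT g1)
  (mg2 : measurable_fun setT g2) (mg3 : measurable_fun setT g3).

Let G (g : T1 * T2 * T3 -> R) w : \bar R := `|2 * f w * g w|%:E.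

Hypothesis sqr_le1 : forall x y z, (f (x, y, z) ^+ 2)%:E <= \int[m1]_s G g1 (s, y, z).
Hypothesis sqr_le2 : forall x y z, (f (x, y, z) ^+ 2)%:E <= \int[m2]_s G g2 (x, s, z).
Hypothesis sqr_le3 : forall x y z, (f (x, y, z) ^+ 2)%:E <= \int[m3]_s G g3 (x, y, s).

Let I (g : T1 * T2 * T3 -> R) : \bar R := \int[m123]_w (g w ^+ 2)%:E.
Let H z : \bar R := \int[m12]_p (f (p, z) ^+ 2)%:E.
Let P (g : T1 * T2 * T3 -> R) z : \bar R := \int[m12]_p (g (p, z) ^+ 2)%:E.
Let X (g : T1 * T2 * T3 -> R) z : \bar R := \int[m12]_p G g (p, z).
Let E : \bar R := I f + I g1 + I g2 + I g3.

Let mslice (g : T1 * T2 * T3 -> R) z : measurable_fun setT g ->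
  measurable_fun setT (fun p => g (p, z)).
Proof. by move=> mg; apply: measurableT_comp => //; exact: pair2_measurable. Qed.

Let mG g : measurable_fun setT g -> measurable_fun setT (G g).
Proof.
move=> mg; apply/measurable_EFinP; apply: measurableT_comp => //.
by apply: measurable_funM => //; exact: measurable_funM.
Qed.

Let G0 g w : 0 <= G g w. Proof. by rewrite lee_fin. Qed.

Let mGz g z : measurable_fun setT g -> measurable_fun setT (fun p => G g (p, z)).
Proof.
by move=> mg; apply: measurableT_comp; [exact: mG|exact: pair2_measurable].
Qed.

Let mX d (T : measurableType d) n (g : T -> R) : measurable_fun setT g ->
  measurable_fun setT (fun w => (g w ^+ n)%:E).
Proof. by move=> mg; apply/measurable_EFinP; exact: measurable_funX. Qed.

Let sqr0 (a : R) : 0 <= (a ^+ 2)%:E. Proof. by rewrite lee_fin sqr_ge0. Qed.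
Let quad0 (a : R) : 0 <= (a ^+ 4)%:E.
Proof. by rewrite lee_fin exprn_even_ge0. Qed.
Let I0 g : 0 <= I g. Proof. exact: integral_ge0. Qed.
Let E0 : 0 <= E. Proof. by rewrite /E; do 3 (apply: adde_ge0 => //). Qed.
Let P0 g z : 0 <= P g z. Proof. exact: integral_ge0. Qed.
Let X0 g z : 0 <= X g z. Proof. exact: integral_ge0. Qed.

(** On the plane at height z, one factor [f^2] is bounded along the first axis,
    hence by a function of y alone, and the other one along the second axis. *)
Let slice4 z : \int[m12]_p (f (p, z) ^+ 4)%:E <= X g1 z * X g2 z.
Proof.
rewrite /X (tonelli_inner_fst _ _ (mGz z mg1) (fun p => @G0 g1 (p, z))).
rewrite (tonelli_inner_snd _ _ (mGz z mg2) (fun p => @G0 g2 (p, z))).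
apply: integral_prod_le => //.
- by apply: mX; exact: mslice.
- exact: (measurable_integral_fst m1 (mGz z mg1) (fun p => @G0 g1 (p, z))).
- by move=> y; exact: integral_ge0.
- exact: (measurable_integral_snd m2 (mGz z mg2) (fun p => @G0 g2 (p, z))).
- by move=> x; exact: integral_ge0.
- by move=> x y; rewrite -[4%N]/(2 + 2)%N exprD EFinM lee_pmul.
Qed.

Let sliceX g z : measurable_fun setT g -> X g z * X g z <= 4%:E * H z * P g z.
Proof.
move=> mg; have mfz := mslice z mf; have mgz := mslice z mg.
have := @integral_CauchySchwarz _ _ _ (m12) (fun p => 2 * f (p, z))%R
  (fun p => g (p, z)).
move=> /(_ (measurable_funM (measurable_cst _) mfz) mgz) /le_trans; apply.
rewrite le_eqVlt; apply/orP; left; apply/eqP; congr (_ * _).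
rewrite /H -ge0_integralZl//; last exact: mX.
by apply: eq_integral => p _; rewrite -EFinM exprMn; congr (_ * _)%:E; ring.
Qed.

(** The estimate along the third axis, integrated over the plane, no longer
    depends on the height z of the plane. *)
Let sliceH z : H z <= E.
Proof.
apply: (@le_trans _ _ (\int[m123]_w G g3 w)).
  rewrite [leRHS](tonelli_inner_snd _ _ (mG mg3) (@G0 g3)).
  apply: ge0_le_integral => //.
  - by apply: mX; exact: mslice.
  - exact: (measurable_integral_snd m3 (mG mg3) (@G0 g3)).
  - by move=> [x y] _; exact: sqr_le3.
apply: (@le_trans _ _ (\int[m123]_w ((f w ^+ 2)%:E + (g3 w ^+ 2)%:E))).
  apply: ge0_le_integral => //.
  - exact: mG.
  - by apply: emeasurable_funD; exact: mX.
  - move=> w _; rewrite /G -EFinD lee_fin ler_norml.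
    have := sqr_ge0 (f w + g3 w)%R; have := sqr_ge0 (f w - g3 w)%R.
    by rewrite !expr2; lra.
rewrite ge0_integralD//; try exact: mX.
by rewrite /E leeD2r// -addeA leeDl// adde_ge0.
Qed.

(** The three functions g1, g2, g3 stand for the partial derivatives of f, and E
    for its squared H^1 norm. Only the bounds of [f^2] by integrals along the
    axes matter, so that the argument takes place on a product of three abstract
    measure spaces. On each plane, [X1 X2 <= X1^2 + X2^2 <= 4 E (P1 + P2)],
    where P1 and P2 integrate over all planes to parts of E. *)
Lemma integral_expr4_le_slices :
  \int[m123]_w (f w ^+ 4)%:E <= 4%:E * E * E.
Proof.
have mP g : measurable_fun setT g -> measurable_fun setT (P g).
  move=> mg; exact: (measurable_integral_fst m12 (mX 2 mg) (fun w => sqr0 (g w))).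
rewrite [leLHS](tonelli_inner_fst _ _ (mX 4 mf) (fun w => quad0 (f w))).
apply: (@le_trans _ _ (\int[m3]_z (4%:E * E * (P g1 z + P g2 z)))).
  apply: ge0_le_integral => //.
  - by move=> z _; exact: integral_ge0.
  - exact: (measurable_integral_fst m12 (mX 4 mf) (fun w => quad0 (f w))).
  - by apply: measurable_funeM; apply: emeasurable_funD; exact: mP.
  move=> z _; apply: le_trans (slice4 z) _.
  apply: (@le_trans _ _ (X g1 z * X g1 z + X g2 z * X g2 z)).
    (* The larger of the two factors, squared, bounds their product. *)
    have [le12|/ltW le21] := leP (X g1 z) (X g2 z).
      by rewrite -[leLHS]add0e leeD ?mule_ge0// lee_wpmul2r.
    by rewrite -[leLHS]adde0 leeD ?mule_ge0// lee_wpmul2l.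
  have S g : measurable_fun setT g -> X g z * X g z <= 4%:E * E * P g z.
    move=> mg; apply: le_trans (sliceX z mg) _; apply: lee_wpmul2r => //.
    exact: lee_wpmul2l.
  rewrite [leRHS](ge0_muleDr (4%:E * E) (P0 g1 z) (P0 g2 z)).
  exact: (leeD (S g1 mg1) (S g2 mg2)).
rewrite ge0_integralZl//; first last.
- exact: mule_ge0.
- by move=> z _; exact: adde_ge0.
- by apply: emeasurable_funD; exact: mP.
apply: lee_wpmul2l; first exact: mule_ge0.
rewrite ge0_integralD//; try exact: mP.
have IP g : measurable_fun setT g -> \int[m3]_z P g z = I g.
  by move=> mg; rewrite /I [RHS](tonelli_inner_fst _ _ (mX 2 mg) (fun w => sqr0 (g w))).
rewrite !IP//; apply: (@le_trans _ _ (I f + (I g1 + I g2))); first by rewrite leeDr.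
by rewrite addeA /E leeDl.
Qed.

End SliceEstimate.

(** * Ladyzhenskaya's inequality *)

Section Ladyzhenskaya.
Context {R : realType}.
Local Notation T := (R3 R).
Local Notation mu := (@mu3 R).
Local Notation leb := (@lebesgue_measure R).
Local Notation leb2 := (@lebesgue_measure R \x @lebesgue_measure R)%E.
Variables (K : set T) (f : T -> R).
Hypothesis fC : C1c K f.

Let G i (w : T) : \bar R := (`|2 * f w * partial i f w|)%:E.

(** Needed to see that a line parallel to an axis leaves every bounded set. *)
Lemma norm_basis3 (i : 'I_3) : 1 <= `|basis3 i : T|.
Proof.
rewrite /Num.norm /= !le_max; case: i => [[|[|[|//]]] ?] /=.
all: by rewrite ?normr1 ?lexx ?orbT.
Qed.

Lemma continuous_line (i : 'I_3) (x : T) :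
  continuous (fun t : R => t *: (basis3 i : T) + x).
Proof.
move=> t; apply: cvgD; last exact: cvg_cst.
by apply: cvgZr_tmp; exact: cvg_id.
Qed.

Lemma sqr_le_integral_line i (x : T) s :
  ((f (s *: basis3 i + x) ^+ 2)%:E <=
   \int[leb]_t G i (t *: basis3 i + x)%R)%E.
Proof.
have [cK _ cf [df cdf] f0] := fC.
pose h t := f (t *: basis3 i + x).
(* The difference quotients of h are those of f in the direction of the axis. *)
have quot t : (fun e : R => e^-1 *: (h (e *: 1 + t) - h t)) =
    (fun e => e^-1 *: (f (e *: basis3 i + (t *: basis3 i + x)) -
                       f (t *: basis3 i + x))).
  by apply/funext => e; rewrite /h addrA -scalerDl [_%:A]mulr1.
have dh t : derivable h t 1.
  by have := df i (t *: basis3 i + x); rewrite /derivable -quot.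
have Dh t : 'D_1 h t = partial i f (t *: basis3 i + x).
  by rewrite /partial /derive -quot.
have [C [_ KC]] := compact_bounded cK.
have := @sqr_le_integral_deriv _ h (`|C| + 1 + `|x|) dh _ _ s.
under eq_integral do rewrite Dh; apply.
- move=> t; rewrite (_ : (fun x0 => 'D_1 h x0) =
    (partial i f) \o (fun t : R => t *: (basis3 i : T) + x)); last first.
    by apply/funext => y /=; rewrite Dh.
  by apply: continuous_comp; [exact: continuous_line|exact: cdf].
- move=> t tM; apply: f0 => /(KC (`|C| + 1)); rewrite /= (le_lt_trans (ler_norm _)) ?ltrDl//.
  move=> /(_ isT); apply/negP; rewrite -ltNge.
  have : `|t *: (basis3 i : T)| <= `|t *: (basis3 i : T) + x| + `|x|.
    by rewrite -{1}(addrK x (t *: _)) (le_trans (ler_normB _ _)).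
  rewrite normrZ; have := norm_basis3 i; have := normr_ge0 t; nra.
Qed.

Let cf : continuous f. Proof. by case: fC. Qed.
Let cdf i : continuous (partial i f). Proof. by case: fC => _ _ _ [_]. Qed.

Definition H1sqr : \bar R :=
  (\int[mu]_w (f w ^+ 2)%:E + \sum_(i < 3) \int[mu]_w (partial i f w ^+ 2)%:E)%E.

Theorem Ladyzhenskaya : (\int[mu]_w (f w ^+ 4)%:E <= 4%:E * H1sqr * H1sqr)%E.
Proof.
pose e0 : 'I_3 := ord0; pose e1 : 'I_3 := lift ord0 ord0.
pose e2 : 'I_3 := lift ord0 (lift ord0 ord0).
have -> : H1sqr = (\int[mu]_w (f w ^+ 2)%:E + \int[mu]_w (partial e0 f w ^+ 2)%:E
    + \int[mu]_w (partial e1 f w ^+ 2)%:E + \int[mu]_w (partial e2 f w ^+ 2)%:E)%E.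
  have sum3 (c : \bar R) (a : 'I_3 -> \bar R) :
      (c + \sum_(i < 3) a i = c + a e0 + a e1 + a e2)%E.
    by rewrite !big_ord_recl big_ord0 adde0 !addeA.
  exact: sum3.
have -> : mu = sigma_product (sigma_product leb leb) leb :> {measure set T -> \bar R}.
  by [].
apply: integral_expr4_le_slices; try exact: continuous_measurable3.
- move=> x y z; have := sqr_le_integral_line e0 (0, y, z) x.
  have E s : s *: (basis3 e0 : T) + (0, y, z) = (s, y, z).
    by congr (_, _, _); rewrite /= ?scaler0 ?add0r// addr0 [_%:A]mulr1.
  by rewrite E; under eq_integral do rewrite E.
- move=> x y z; have := sqr_le_integral_line e1 (x, 0, z) y.
  have E s : s *: (basis3 e1 : T) + (x, 0, z) = (x, s, z).
    by congr (_, _, _); rewrite /= ?scaler0 ?add0r// addr0 [_%:A]mulr1.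
  by rewrite E; under eq_integral do rewrite E.
- move=> x y z; have := sqr_le_integral_line e2 (x, y, 0) z.
  have E s : s *: (basis3 e2 : T) + (x, y, 0) = (x, y, s).
    by congr (_, _, _); rewrite /= ?scaler0 ?add0r// addr0 [_%:A]mulr1.
  by rewrite E; under eq_integral do rewrite E.
Qed.

End Ladyzhenskaya.

(** * The space H^1_0 *)

Section Sobolev.
Context {R : realType}.
Variable Omega : set (R3 R).
Hypothesis Omega_open : open Omega.
Local Notation T := (R3 R).
Local Notation mu := (@mu3 R).
Local Notation S q := (sqint mu Omega q).
Implicit Types (q r : T -> R) (g h : T -> 'rV[R]_3) (i : 'I_3).

Lemma measurable_Omega : measurable Omega.
Proof. exact: open_measurable3. Qed.
Let mO := measurable_Omega.

Lemma sqint_restrict q : sqint mu setT q -> S q.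
Proof.
move=> [mq q2]; split; first exact: measurable_funTS.
by apply: integrableS q2.
Qed.

Lemma test_sqint phi : test_function Omega phi -> S phi.
Proof. by move=> /test_function_C1c[K _ KC]; exact/sqint_restrict/(C1c_sqint KC). Qed.

Lemma test_sqint_partial phi i : test_function Omega phi -> S (partial i phi).
Proof.
by move=> /test_function_C1c[K _ KC]; exact/sqint_restrict/(C1c_sqint_partial i KC).
Qed.

Lemma test_measurable phi : test_function Omega phi -> measurable_fun Omega phi.
Proof. by move=> /test_sqint[]. Qed.

Lemma test_bounded phi : test_function Omega phi -> exists C, forall x, `|phi x| <= C.
Proof.
move=> /test_function_C1c[K _ [cK _ cf _ f0]]; exact: compact_support_bounded f0.
Qed.

Lemma test_bounded_partial phi i : test_function Omega phi ->
  exists C, forall x, `|partial i phi x| <= C.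
Proof.
move=> /test_function_C1c[K _ [cK clK cf [_ cdf] f0]].
apply: (compact_support_bounded cK) => // x; exact: partial_out f0.
Qed.

Definition normsq q g : R :=
  \int[mu]_(x in Omega) (q x ^+ 2) + \sum_(i < 3) \int[mu]_(x in Omega) (g x 0 i ^+ 2).

Lemma dotv_sqr (a : 'rV[R]_3) : dotv a a = \sum_i a 0 i ^+ 2.
Proof. by apply: eq_bigr => i _; rewrite expr2. Qed.

Lemma H1normE q g : S q -> L2v Omega g -> H1norm Omega q g = Num.sqrt (normsq q g).
Proof.
move=> Sq Sg; rewrite /H1norm /normsq RintegralD//; last 2 first.
- exact: Sq.2.
- rewrite (_ : (fun x => dotv _ _) = fun x => \sum_i g x 0 i ^+ 2).
    by apply: intble_sum => // i; exact: (Sg i).2.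
  by apply/funext => x; exact: dotv_sqr.
under [X in _ + X]eq_Rintegral do rewrite dotv_sqr.
by rewrite Rintegral_sum// => i; exact: (Sg i).2.
Qed.

Definition test_approx (phi : nat -> T -> R) q g : Prop :=
  [/\ forall n, test_function Omega (phi n), L2cvg mu Omega phi q &
      forall i, L2cvg mu Omega (fun n => partial i (phi n)) (fun x => g x 0 i)].

(** The norm [H1norm] is computed from a real-valued integral, which is 0 by
    convention when the integrand is not integrable. Its convergence to 0 is
    therefore informative only because the derivatives of a test function are
    square integrable, which is what the equivalence rests on. *)
Lemma test_approxP phi q g : S q -> L2v Omega g ->
  (forall n, test_function Omega (phi n)) ->
  H1norm Omega (fun x => phi k x - q x) (fun x => grad (phi k) x - g x)
      @[k --> \oo] --> (0 : R) <-> test_approx phi q g.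
Proof.
move=> Sq Sg Tphi.
have Sd n : S (fun x => phi n x - q x) by apply: sqintB => //; exact: test_sqint.
have gE n i : (fun x => (grad (phi n) x - g x) 0 i) =
    (fun x => partial i (phi n) x - g x 0 i) by apply/funext => x; rewrite !mxE.
have Sdg n : L2v Omega (fun x => grad (phi n) x - g x).
  move=> i; rewrite gE; apply: sqintB => //; [exact: test_sqint_partial|exact: Sg].
have NE n := H1normE (Sd n) (Sdg n).
have NE2 n : normsq (fun x => phi n x - q x) (fun x => grad (phi n) x - g x) =
    \int[mu]_(x in Omega) ((phi n x - q x) ^+ 2) +
    \sum_(i < 3) \int[mu]_(x in Omega) ((partial i (phi n) x - g x 0 i) ^+ 2).
  rewrite /normsq; congr (_ + _); apply: eq_bigr => i _.
  by apply: eq_Rintegral => x _; have /funeqP/(_ x) -> := gE n i.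
have pos (F : T -> R) : 0 <= \int[mu]_(x in Omega) (F x ^+ 2).
  by apply: Rintegral_ge0 => x _; exact: sqr_ge0.
split=> [cv|[_ cq cg]].
  have cv2 : normsq (fun x => phi n x - q x) (fun x => grad (phi n) x - g x)
      @[n --> \oo] --> (0 : R).
    rewrite -[X in _ --> X](mulr0 0).
    rewrite (_ : (fun n => _) = (fun n =>
      H1norm Omega (fun x => phi n x - q x) (fun x => grad (phi n) x - g x) *
      H1norm Omega (fun x => phi n x - q x) (fun x => grad (phi n) x - g x)));
      first exact: cvgM.
    apply/funext => n; rewrite NE -expr2 sqr_sqrtr// NE2 addr_ge0//.
    by apply: sumr_ge0 => i _; exact: pos.
  split=> // [|i].
  - apply: (@squeeze_cvgr _ _ _ _ (cst 0) _ _ _ _ (cvg_cst _) cv2).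
    apply: nearW => n; rewrite pos /= NE2 lerDl.
    by apply: sumr_ge0 => j _; exact: pos.
  - apply: (@squeeze_cvgr _ _ _ _ (cst 0) _ _ _ _ (cvg_cst _) cv2).
    apply: nearW => n; rewrite pos /= NE2 (bigD1 i)//= addrCA lerDl addr_ge0//.
    by apply: sumr_ge0 => j _; exact: pos.
rewrite (_ : (fun n => _) = (fun n => Num.sqrt (
    \int[mu]_(x in Omega) ((phi n x - q x) ^+ 2) +
    \sum_(i < 3) \int[mu]_(x in Omega) ((partial i (phi n) x - g x 0 i) ^+ 2)))).
  rewrite -[X in _ --> X](sqrtr0 R).
  apply: continuous_cvg; first exact: sqrt_continuous.
  rewrite -[X in _ --> X](addr0 0); apply: cvgD => //.
  rewrite -[X in _ --> X](_ : \sum_(i < 3) 0 = 0 :> R); last by rewrite big1.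
  by apply: cvg_big => [|i _]; [exact: add_continuous|exact: cg].
by apply/funext => n; rewrite NE NE2.
Qed.

Lemma H10P q g : H10 Omega q g <->
  [/\ S q, L2v Omega g, weak_grad Omega q g & exists phi, test_approx phi q g].
Proof.
split=> [[[Sq Sg wg] [phi [Tphi cphi]]]|[Sq Sg wg [phi aphi]]].
  by split => //; exists phi; apply/test_approxP.
split; first by split.
by exists phi; split; [case: aphi|apply/test_approxP => //; case: aphi].
Qed.

Lemma test_partial_out phi i x : test_function Omega phi -> ~ Omega x ->
  phi x = 0 /\ partial i phi x = 0.
Proof.
move=> /test_function_C1c[K KO [_ clK _ _ f0]] nOx.
have nKx : ~ K x by move/KO.
by split; [exact: f0|exact: partial_out f0 nKx].
Qed.

Lemma test_quadint phi : test_function Omega phi -> quadint mu Omega phi.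
Proof.
by move=> Tphi; apply: test_sqint; rewrite /= ; exact: (test_functionM Tphi Tphi).
Qed.

(** A test function and its derivatives vanish outside [Omega], so the integrals
    over the whole space in Ladyzhenskaya's inequality live on [Omega]. *)
Lemma test_integral4 phi : test_function Omega phi ->
  \int[mu]_(x in Omega) (phi x ^+ 4) <= 4 * normsq phi (grad phi) ^+ 2.
Proof.
move=> Tphi; have [K KO KC] := test_function_C1c Tphi.
have Lady := Ladyzhenskaya KC.
have toO (F : T -> R) n : (0 < n)%N -> (forall x, ~ Omega x -> F x = 0) ->
    (\int[mu]_w (F w ^+ n)%:E = \int[mu]_(w in Omega) (F w ^+ n)%:E)%E.
  move=> n0 F0; rewrite [RHS]integral_mkcond; apply: eq_integral => w _.
  rewrite patchE; case: ifPn => //; rewrite notin_setE => /F0 ->.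
  by rewrite expr0n -[n == 0%N]negbK -lt0n n0.
have ER (F : T -> R) : S F -> (\int[mu]_(x in Omega) (F x ^+ 2))%:E =
    (\int[mu]_(x in Omega) (F x ^+ 2)%:E)%E.
  by move=> SF; rewrite fineK//; exact: (integrable_fin_num mO SF.2).
have E4 : (\int[mu]_(x in Omega) (phi x ^+ 4))%:E = (\int[mu]_(x in Omega) (phi x ^+ 4)%:E)%E.
  rewrite fineK//; have := integrable_fin_num mO (test_quadint Tphi).2.
  by under eq_integral do rewrite /= -exprM.
have EN : H1sqr phi = (normsq phi (grad phi))%:E.
  rewrite /H1sqr /normsq EFinD ER; last exact: test_sqint.
  rewrite toO//; last by move=> x /(test_partial_out ord0 Tphi)[].
  congr (_ + _)%E; rewrite -sumEFin; apply: eq_bigr => i _.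
  rewrite toO//; last by move=> x /(test_partial_out i Tphi)[].
  rewrite -ER; last exact: test_sqint_partial.
  by congr EFin; apply: eq_Rintegral => x _; rewrite mxE.
rewrite -lee_fin E4 -toO//; last by move=> x /(test_partial_out ord0 Tphi)[].
by apply: le_trans Lady _; rewrite EN -!EFinM expr2 mulrA.
Qed.

(** Along the approximating test functions the L^4 norm is lower semicontinuous
    and the H^1 norm is continuous. *)
Lemma test_approx_L4 phi q g : S q -> L2v Omega g -> test_approx phi q g ->
  quadint mu Omega q /\
  \int[mu]_(x in Omega) (q x ^+ 4) <= 4 * normsq q g ^+ 2.
Proof.
move=> Sq Sg [Tphi cq cg].
apply: (@quadint_limit _ _ _ mu Omega mO phi q
  (fun n => 4 * normsq (phi n) (grad (phi n)) ^+ 2)) => //.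
- by move=> n; exact: test_sqint.
- by move=> n; exact: test_quadint.
- by move=> n; exact: test_integral4.
have cN : normsq (phi n) (grad (phi n)) @[n --> \oo] --> normsq q g.
  apply: cvgD.
    by apply: L2cvg_Rintegral_sqr => // n; exact: test_sqint.
  apply: cvg_big => [|i _]; first exact: add_continuous.
  rewrite (_ : (fun n => _) = fun n => \int[mu]_(x in Omega) (partial i (phi n) x ^+ 2)).
    apply: L2cvg_Rintegral_sqr => //; [move=> n; exact: test_sqint_partial|exact: Sg].
  by apply/funext => n; apply: eq_Rintegral => x _; rewrite mxE.
by apply: cvgM; [exact: cvg_cst|rewrite expr2; exact: cvgM].
Qed.

Lemma test_approx_linear a phi psi q g r h : S q -> L2v Omega g -> S r ->
  L2v Omega h -> test_approx phi q g -> test_approx psi r h ->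
  test_approx (fun n x => a * phi n x + psi n x) (fun x => a * q x + r x)
    (fun x => a *: g x + h x).
Proof.
move=> Sq Sg Sr Sh [Tphi cq cg] [Tpsi cr ch]; split.
- by move=> n; exact: test_function_linear.
- by apply: L2cvg_linear => // n; exact: test_sqint.
move=> i; have df n x : derivable (phi n) x (basis3 i) by have [/(_ [::])[_]] := Tphi n.
have dp n x : derivable (psi n) x (basis3 i) by have [/(_ [::])[_]] := Tpsi n.
rewrite (_ : (fun n => _) = (fun n x => a * partial i (phi n) x + partial i (psi n) x)).
  rewrite (_ : (fun x => _) = (fun x => a * g x 0 i + h x 0 i)).
    apply: L2cvg_linear => //; [|exact: Sg| |exact: Sh].
    + by move=> n; exact: test_sqint_partial.
    + by move=> n; exact: test_sqint_partial.
  by apply/funext => x; rewrite !mxE.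
apply/funext => n; apply/funext => x; rewrite partialD//; last exact: derivableZ.
by rewrite partialZ.
Qed.

(** With [r = q] this scales an element of H^1_0, as the homogeneity argument
    for the dual norm requires. *)
Lemma H10_linear a q g r h : H10 Omega q g -> H10 Omega r h ->
  H10 Omega (fun x => a * q x + r x) (fun x => a *: g x + h x).
Proof.
move=> /H10P[Sq Sg wq [phi aphi]] /H10P[Sr Sh wr [psi apsi]]; apply/H10P; split.
- by apply: sqintD => //; exact: sqintZ.
- move=> i; rewrite (_ : (fun x => _) = (fun x => a * g x 0 i + h x 0 i)).
    by apply: sqintD; [|apply: sqintZ; [|exact: Sg]|exact: Sh].
  by apply/funext => x; rewrite !mxE.
- move=> chi Tchi i.
  have Schi := test_sqint Tchi; have Sdchi := test_sqint_partial i Tchi.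
  transitivity (a * \int[mu]_(x in Omega) (q x * partial i chi x) +
      \int[mu]_(x in Omega) (r x * partial i chi x)).
    rewrite -RintegralZl//; last exact: sqintM.
    rewrite -RintegralD//; [|exact: (intbleZ mO a (sqintM mO Sq Sdchi))|exact: sqintM].
    by apply: eq_Rintegral => x _; ring.
  rewrite wq// wr// mulrN -opprD; congr (- _).
  rewrite -RintegralZl//; last by apply: sqintM => //; exact: Sg.
  rewrite -RintegralD//.
  - by apply: eq_Rintegral => x _; rewrite !mxE; ring.
  - exact: (intbleZ mO a (sqintM mO (Sg i) Schi)).
  - exact: (sqintM mO (Sh i) Schi).
- by exists (fun n x => a * phi n x + psi n x); exact: test_approx_linear.
Qed.

Lemma H10_quadint q g : H10 Omega q g -> quadint mu Omega q.
Proof.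
by move=> /H10P[Sq Sg _ [phi aphi]]; have [] := test_approx_L4 Sq Sg aphi.
Qed.

Lemma normsq_test_approx_cvg0 phi q g : S q -> L2v Omega g -> test_approx phi q g ->
  normsq (fun x => phi n x - q x) (fun x => grad (phi n) x - g x)
    @[n --> \oo] --> (0 : R).
Proof.
move=> Sq Sg [Tphi cq cg].
rewrite -[X in _ --> X](_ : 0 + \sum_(i < 3) 0 = 0 :> R); last by rewrite big1 ?addr0.
apply: cvgD => //; apply: cvg_big => [|i _]; first exact: add_continuous.
rewrite (_ : (fun n => _) =
  fun n => \int[mu]_(x in Omega) ((partial i (phi n) x - g x 0 i) ^+ 2)).
  exact: cg.
by apply/funext => n; apply: eq_Rintegral => x _; rewrite !mxE.
Qed.

(** The error [phi_n - q] is itself approximated by test functions, so that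
    Ladyzhenskaya's inequality applies to it. *)
Lemma test_approx_shift phi q g n : S q -> L2v Omega g -> test_approx phi q g ->
  test_approx (fun m x => phi n x - phi m x) (fun x => phi n x - q x)
    (fun x => grad (phi n) x - g x).
Proof.
move=> Sq Sg aphi; have [Tphi cq cg] := aphi.
have aconst : test_approx (fun _ => phi n) (phi n) (grad (phi n)).
  split=> // [|i].
  - rewrite /L2cvg; under eq_cvg do under eq_Rintegral do rewrite subrr expr0n.
    by rewrite Rintegral_cst// mul0r; exact: cvg_cst.
  - rewrite /L2cvg; under eq_cvg do under eq_Rintegral do rewrite mxE subrr expr0n.
    by rewrite Rintegral_cst// mul0r; exact: cvg_cst.
have Sg' : L2v Omega (grad (phi n)).
  move=> i; rewrite (_ : (fun x => _) = partial i (phi n)); first exact: test_sqint_partial.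
  by apply/funext => x; rewrite mxE.
have := @test_approx_linear (-1) _ _ _ _ _ _ Sq Sg (test_sqint (Tphi n)) Sg' aphi aconst.
congr test_approx.
- by apply/funext => m; apply/funext => x; rewrite mulN1r addrC.
- by apply/funext => x; rewrite mulN1r addrC.
- by apply/funext => x; rewrite scaleN1r addrC.
Qed.

(** Ladyzhenskaya's inequality for the error [phi_n - q] bounds its L^4 norm by
    its H^1 norm. *)
Lemma test_approx_L4cvg phi q g : S q -> L2v Omega g -> test_approx phi q g ->
  \int[mu]_(x in Omega) ((phi n x - q x) ^+ 4) @[n --> \oo] --> (0 : R).
Proof.
move=> Sq Sg aphi; have [Tphi _ _] := aphi.
have Sg' n : L2v Omega (fun x => grad (phi n) x - g x).
  move=> i; rewrite (_ : (fun x => _) = (fun x => partial i (phi n) x - g x 0 i)).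
    by apply: sqintB => //; [exact: test_sqint_partial|exact: Sg].
  by apply/funext => x; rewrite !mxE.
have c0 := normsq_test_approx_cvg0 Sq Sg aphi.
apply: (@squeeze_cvgr _ _ _ _ (cst 0) (fun n => 4 *
  normsq (fun x => phi n x - q x) (fun x => grad (phi n) x - g x) ^+ 2)).
- apply: nearW => n; apply/andP; split.
    by apply: Rintegral_ge0 => x _; rewrite exprn_even_ge0.
  apply: (test_approx_L4 _ (Sg' n) (test_approx_shift n Sq Sg aphi)).2.
  by apply: sqintB => //; exact: test_sqint.
- exact: cvg_cst.
- rewrite -[X in _ --> X](_ : 4 * (0 * 0) = 0 :> R); last by rewrite !mulr0.
  by apply: cvgM; [exact: cvg_cst|exact: cvgM].
Qed.

(** By the Cauchy-Schwarz inequality, [\int c^2 (phi_n - q)^2] is at most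
    [(\int c^4 \int (phi_n - q)^4)^(1/2)]. *)
Lemma L2cvg_mul (phi : nat -> T -> R) q c : (forall n, test_function Omega (phi n)) ->
  measurable_fun Omega q -> measurable_fun Omega c ->
  quadint mu Omega q -> quadint mu Omega c ->
  (forall n, quadint mu Omega (fun x => phi n x - q x)) ->
  \int[mu]_(x in Omega) ((phi n x - q x) ^+ 4) @[n --> \oo] --> (0 : R) ->
  L2cvg mu Omega (fun n x => c x * phi n x) (fun x => c x * q x).
Proof.
move=> Tphi mq mc q4 c4 d4 cv.
apply: (@squeeze_cvgr _ _ _ _ (cst 0) (fun n => Num.sqrt
  (\int[mu]_(x in Omega) (c x ^+ 4) * \int[mu]_(x in Omega) ((phi n x - q x) ^+ 4)))).
- apply: nearW => n; apply/andP; split.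
    by apply: Rintegral_ge0 => x _; rewrite sqr_ge0.
  rewrite -ler_sqr ?nnegrE ?sqrtr_ge0//; last first.
    by apply: Rintegral_ge0 => x _; rewrite sqr_ge0.
  rewrite sqr_sqrtr; last first.
    by apply: mulr_ge0; apply: Rintegral_ge0 => x _; rewrite exprn_even_ge0.
  have := Rintegral_CauchySchwarz mO c4 (d4 n).
  under eq_Rintegral do rewrite -exprMn mulrBr.
  by under [X in _ <= X * _ -> _]eq_Rintegral do rewrite -exprM;
     under [X in _ <= _ * X -> _]eq_Rintegral do rewrite -exprM.
- exact: cvg_cst.
- rewrite -[X in _ --> X](sqrtr0 R).
  apply: continuous_cvg; first exact: sqrt_continuous.
  rewrite -[X in _ --> X](mulr0 (\int[mu]_(x in Omega) (c x ^+ 4))).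
  by apply: cvgM => //; exact: cvg_cst.
Qed.

(** The definition of the weak derivative of a, tested with [psi chi]. *)
Lemma integral_partial_test i a A psi chi : H10 Omega a A ->
  test_function Omega psi -> test_function Omega chi ->
  \int[mu]_(x in Omega) ((A x 0 i * psi x) * chi x)
  + \int[mu]_(x in Omega) ((a x * psi x) * partial i chi x)
  + \int[mu]_(x in Omega) ((a x * partial i psi x) * chi x) = 0.
Proof.
move=> /H10P[Sa SA wa _] Tpsi Tchi.
have [C psiC] := test_bounded Tpsi; have [C' dpsiC] := test_bounded_partial i Tpsi.
have mpsi := test_measurable Tpsi; have mdpsi := (test_sqint_partial i Tpsi).1.
have Sapsi := sqint_bounded mO mpsi psiC Sa.
have Sadpsi := sqint_bounded mO mdpsi dpsiC Sa.
have SApsi := sqint_bounded mO mpsi psiC (SA i).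
have Schi := test_sqint Tchi; have Sdchi := test_sqint_partial i Tchi.
have := wa _ (test_functionM Tpsi Tchi) i.
have dpsi x : derivable psi x (basis3 i) by have [/(_ [::])[_]] := Tpsi.
have dchi x : derivable chi x (basis3 i) by have [/(_ [::])[_]] := Tchi.
rewrite (@eq_Rintegral _ _ _ mu Omega (fun x => (a x * psi x) * partial i chi x +
  (a x * partial i psi x) * chi x)); last first.
  by move=> x _; rewrite partialM//; ring.
rewrite RintegralD//; [|exact: (sqintM mO Sapsi Sdchi)|exact: (sqintM mO Sadpsi Schi)].
rewrite [in RHS](@eq_Rintegral _ _ _ mu Omega (fun x => (A x 0 i * psi x) * chi x)); last first.
  by move=> x _; rewrite mulrA.
by move=> E; rewrite -addrA E subrr.
Qed.

Lemma lim_add3_eq0 (F G H : nat -> R) (x y z : R) : F n @[n --> \oo] --> x ->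
  G n @[n --> \oo] --> y -> H n @[n --> \oo] --> z ->
  (forall n, F n + G n + H n = 0) -> x + y + z = 0.
Proof.
move=> cF cG cH E.
have cv : F n + G n + H n @[n --> \oo] --> x + y + z.
  by apply: cvgD => //; exact: cvgD.
rewrite -(cvg_lim (@Rhausdorff R) cv) (_ : (fun n => _) = cst 0) ?lim_cst//.
by apply/funext => n; exact: E.
Qed.

(** The integral of the i-th derivative of the product [a b c] vanishes on
    H^1_0. One factor at a time goes from test functions to the limit: for c the
    other factor is a fixed bounded test function, so that weak L^2 convergence
    is enough; for b the products [c psi_n] and [a psi_n] have to converge in
    L^2, which is where L^4 convergence enters. *)
Lemma integral_partial_mul3 i a A b B c C :
  H10 Omega a A -> H10 Omega b B -> H10 Omega c C ->
  \int[mu]_(x in Omega) (A x 0 i * (c x * b x))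
  + \int[mu]_(x in Omega) (C x 0 i * (a x * b x))
  + \int[mu]_(x in Omega) ((a x * c x) * B x 0 i) = 0.
Proof.
move=> Ha Hb Hc; have a4 := H10_quadint Ha; have b4 := H10_quadint Hb.
have c4 := H10_quadint Hc.
have /H10P[Sa SA wa _] := Ha; have /H10P[Sb SB wb [psi apsi]] := Hb.
have /H10P[Sc SC wc [chi achi]] := Hc.
have [Tpsi cpsi dpsi] := apsi; have [Tchi cchi dchi] := achi.
have b4cvg := test_approx_L4cvg Sb SB apsi.
have psib4 n : quadint mu Omega (fun x => psi n x - b x).
  have SB' : L2v Omega (fun x => grad (psi n) x - B x).
    move=> j; rewrite (_ : (fun x => _) = (fun x => partial j (psi n) x - B x 0 j)).
      by apply: sqintB => //; [exact: test_sqint_partial|exact: SB].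
    by apply/funext => x; rewrite !mxE.
  apply: (test_approx_L4 _ SB' (test_approx_shift n Sb SB apsi)).1.
  by apply: sqintB => //; exact: test_sqint.
(* The limit in the third function, for a fixed test function psi_n. *)
have semi n : \int[mu]_(x in Omega) ((A x 0 i * psi n x) * c x)
    + \int[mu]_(x in Omega) ((a x * psi n x) * C x 0 i)
    + \int[mu]_(x in Omega) ((a x * partial i (psi n) x) * c x) = 0.
  have [K psiK] := test_bounded (Tpsi n).
  have [K' dpsiK] := test_bounded_partial i (Tpsi n).
  have mpsi := test_measurable (Tpsi n); have mdpsi := (test_sqint_partial i (Tpsi n)).1.
  have Tc m := test_sqint (Tchi m).
  have Tdc m := test_sqint_partial i (Tchi m).
  apply: (lim_add3_eq0 _ _ _ (fun m => integral_partial_test i Ha (Tpsi n) (Tchi m))).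
  - apply: Rintegral_cvg_sqint => //; exact: (sqint_bounded mO mpsi psiK (SA i)).
  - apply: Rintegral_cvg_sqint => //; first exact: (sqint_bounded mO mpsi psiK Sa).
      exact: SC.
    exact: dchi.
  - apply: Rintegral_cvg_sqint => //; exact: (sqint_bounded mO mdpsi dpsiK Sa).
have mpsi n := test_measurable (Tpsi n).
have psi4 n := test_quadint (Tpsi n).
apply: (lim_add3_eq0 _ _ _ semi).
- rewrite (_ : (fun n => _) = (fun n =>
    \int[mu]_(x in Omega) (A x 0 i * (c x * psi n x)))).
    apply: Rintegral_cvg_sqint => //.
    + exact: SA.
    + by move=> n; apply: (sqint_mul mO) => //; exact: Sc.1.
    + by apply: (sqint_mul mO) => //; [exact: Sc.1|exact: Sb.1].
    + by apply: L2cvg_mul => //; [exact: Sb.1|exact: Sc.1].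
  by apply/funext => n; apply: eq_Rintegral => x _; ring.
- rewrite (_ : (fun n => _) = (fun n =>
    \int[mu]_(x in Omega) (C x 0 i * (a x * psi n x)))).
    apply: Rintegral_cvg_sqint => //.
    + exact: SC.
    + by move=> n; apply: (sqint_mul mO) => //; exact: Sa.1.
    + by apply: (sqint_mul mO) => //; [exact: Sa.1|exact: Sb.1].
    + by apply: L2cvg_mul => //; [exact: Sb.1|exact: Sa.1].
  by apply/funext => n; apply: eq_Rintegral => x _; ring.
- rewrite (_ : (fun n => _) = (fun n =>
    \int[mu]_(x in Omega) ((a x * c x) * partial i (psi n) x))).
    apply: Rintegral_cvg_sqint => //.
    + by apply: (sqint_mul mO) => //; [exact: Sa.1|exact: Sc.1].
    + by move=> n; exact: test_sqint_partial.
    + exact: SB.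
    + exact: dpsi.
  by apply/funext => n; apply: eq_Rintegral => x _; ring.
Qed.

End Sobolev.

(** * The energy balance of one step *)

Section VectorFields.
Context {R : realType}.
Variable Omega : set (R3 R).
Hypothesis Omega_open : open Omega.
Local Notation T := (R3 R).
Local Notation mu := (@mu3 R).
Local Notation S q := (sqint mu Omega q).
Local Notation intble q := (mu.-integrable Omega (EFin \o q)).
Implicit Types (v w : T -> 'rV[R]_3) (Dv Dw : T -> 'M[R]_3) (i j : 'I_3).
Let mO : measurable Omega := open_measurable3 Omega_open.

Lemma H10v_L2v v Dv : H10v Omega v Dv -> L2v Omega v.
Proof. by move=> Hv i; have /(H10P Omega_open)[] := Hv i. Qed.

Lemma H10v_grad v Dv i j : H10v Omega v Dv -> S (fun x => Dv x i j).
Proof.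
move=> Hv; have /(H10P Omega_open)[_ /(_ j) + _ _] := Hv i.
by congr sqint; apply/funext => x; rewrite mxE.
Qed.

Lemma intble_dotv v w : L2v Omega v -> L2v Omega w ->
  intble (fun x => dotv (v x) (w x)).
Proof. by move=> Sv Sw; apply: intble_sum => // i; exact: (sqintM mO (Sv i) (Sw i)). Qed.

Lemma intble_dotm Dv Dw : (forall i j, S (fun x => Dv x i j)) ->
  (forall i j, S (fun x => Dw x i j)) -> intble (fun x => dotm (Dv x) (Dw x)).
Proof.
move=> Sv Sw; apply: intble_sum => // i; apply: intble_sum => // j.
exact: (sqintM mO (Sv i j) (Sw i j)).
Qed.

Lemma L2vB v w : L2v Omega v -> L2v Omega w -> L2v Omega (fun x => v x - w x).
Proof.
move=> Sv Sw i; rewrite (_ : (fun x => _) = fun x => v x 0 i - w x 0 i).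
  by apply: sqintB; [|exact: Sv|exact: Sw].
by apply/funext => x; rewrite !mxE.
Qed.

Lemma H10v_linear a v Dv w Dw : H10v Omega v Dv -> H10v Omega w Dw ->
  H10v Omega (fun x => a *: v x + w x) (fun x => a *: Dv x + Dw x).
Proof.
move=> Hv Hw i; have := H10_linear Omega_open a (Hv i) (Hw i).
by congr H10; apply/funext => x; [rewrite !mxE|apply/rowP => j; rewrite !mxE].
Qed.

(** The integrand is the sum over i, j of half of [d_j (v_j v_i v_i)]: the term
    [(div v) v / 2] supplies exactly the derivatives that fall on the advecting
    velocity. *)
Lemma skew_advection v Dv : H10v Omega v Dv ->
  \int[mu]_(x in Omega)
    dotv (advection v Dv x + (2^-1 * div Dv x) *: v x) (v x) = 0.
Proof.
move=> Hv.
have Sv := H10v_L2v Hv; have SD i j := H10v_grad i j Hv.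
have v4 i : quadint mu Omega (fun x => v x 0 i).
  exact: (H10_quadint Omega_open (Hv i)).
have Svv i j : S (fun x => v x 0 i * v x 0 j).
  by apply: (sqint_mul mO) => //; [exact: (Sv i).1|exact: (Sv j).1].
have E x : dotv (advection v Dv x + (2^-1 * div Dv x) *: v x) (v x) =
  \sum_i \sum_j (2^-1 * (Dv x j j * (v x 0 i * v x 0 i)) +
    2^-1 * (Dv x i j * (v x 0 j * v x 0 i)) + 2^-1 * ((v x 0 j * v x 0 i) * Dv x i j)).
  apply: eq_bigr => i _; rewrite !mxE mulrDl /div /mxtrace mulr_suml.
  rewrite mulr_sumr mulr_suml mulr_suml -big_split /=.
  by apply: eq_bigr => j _; rewrite mxE; field.
rewrite (@eq_Rintegral _ _ _ mu Omega _ _ (fun x _ => E x)).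
have I1 i j : intble (fun x => Dv x j j * (v x 0 i * v x 0 i)) by exact: sqintM.
have I2 i j : intble (fun x => Dv x i j * (v x 0 j * v x 0 i)) by exact: sqintM.
have I3 i j : intble (fun x => (v x 0 j * v x 0 i) * Dv x i j) by exact: sqintM.
have Isum i j := intbleD mO (intbleD mO (intbleZ mO 2^-1 (I1 i j))
  (intbleZ mO 2^-1 (I2 i j))) (intbleZ mO 2^-1 (I3 i j)).
rewrite Rintegral_sum//; last by move=> i; apply: intble_sum => // j; exact: Isum.
apply: big1 => i _; rewrite Rintegral_sum//.
apply: big1 => j _; rewrite Rintegral_lin3// -!mulrDr.
apply/eqP; rewrite mulf_eq0; apply/orP; right; apply/eqP.
rewrite -[RHS](integral_partial_mul3 Omega_open j (Hv j) (Hv i) (Hv i)).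
by congr (_ + _ + _); apply: eq_Rintegral => x _; rewrite mxE.
Qed.

(** By homogeneity: [t v] is admissible in the supremum as soon as
    [t ||grad v|| <= 1]. *)
Lemma Hm1_le f v Dv : Hm1 Omega f -> H10v Omega v Dv ->
  f v <= fine (Hm1norm Omega f) * L2norm_grad Omega Dv.
Proof.
move=> [flin fy] Hv; set s := L2norm_grad Omega Dv.
have s0 : 0 <= s by exact: sqrtr_ge0.
set M := fine (Hm1norm Omega f).
have scal t : 0 < t -> t * s <= 1 -> t * f v <= M.
  move=> t0 ts1.
  (* The field t v is represented as (t - 1) v + v, on which f is known to be
     linear. *)
  have Hw := H10v_linear (t - 1) Hv Hv.
  have norm_w : L2norm_grad Omega (fun x => (t - 1) *: Dv x + Dv x) = t * s.
    rewrite /s /L2norm_grad -[in RHS](gtr0_norm t0) -sqrtr_sqr -sqrtrM ?sqr_ge0//.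
    have ID := intble_dotm (fun i j => H10v_grad i j Hv) (fun i j => H10v_grad i j Hv).
    congr Num.sqrt.
    transitivity (\int[mu]_(x in Omega) (t ^+ 2 * dotm (Dv x) (Dv x))).
      apply: eq_Rintegral => x _; rewrite /dotm mulr_sumr; apply: eq_bigr => i _.
      by rewrite mulr_sumr; apply: eq_bigr => j _; rewrite !mxE; ring.
    exact: (RintegralZl _ mO ID).
  have fw : t * f v = f (fun x => (t - 1) *: v x + v x).
    by rewrite (flin _ _ _ _ _ Hv Hv); ring.
  have le_sup : ((f (fun x => (t - 1) *: v x + v x)%R)%:E <= Hm1norm Omega f)%E.
    apply: ereal_sup_ubound; exists (fun x => (t - 1) *: v x + v x) => //.
    by exists (fun x => (t - 1) *: Dv x + Dv x) => //; rewrite norm_w.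
  rewrite fw /M -lee_fin fineK//.
  by rewrite fin_numElt fy andbT; exact: lt_le_trans (ltNyr _) le_sup.
have [s_eq0|s_neq0] := eqVneq s 0.
  rewrite s_eq0 mulr0 leNgt; apply/negP => fv0.
  have M0 : f v <= M by rewrite -[f v]mul1r; apply: scal => //; rewrite s_eq0 mulr0.
  (* With a vanishing gradient norm every multiple of v is admissible; this one
     would give f the value M + 1. *)
  have t0 : 0 < (M + 1) / f v by apply: divr_gt0 => //; lra.
  have := scal _ t0; rewrite s_eq0 mulr0 divfK ?gt_eqF// => /(_ ler01).
  lra.
have sp : 0 < s by rewrite lt_def s_neq0.
have := scal s^-1; rewrite invr_gt0 mulVf// => /(_ sp (lexx _)).
by rewrite mulrC ler_pdivrMr.
Qed.

Lemma Rintegral_kinetic_pressure e v (p : T -> R) : L2v Omega v -> S p ->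
  \int[mu]_(x in Omega) (dotv (v x) (v x) + e * `|p x| ^+ 2) =
  \int[mu]_(x in Omega) dotv (v x) (v x) + e * \int[mu]_(x in Omega) (p x ^+ 2).
Proof.
move=> Sv Sp; rewrite -(RintegralZl _ mO Sp.2) -(RintegralD mO (intble_dotv Sv Sv)).
  by apply: eq_Rintegral => x _; rewrite real_normK ?num_real.
exact: intbleZ Sp.2.
Qed.

(** In [transport] and [pressure], polarization turns each time difference into
    an increment of the energy plus a dissipation. The pressure work is an exact
    increment because, by the continuity equation,
    [- k p' div D = e' p'^2 / 2 + e p'^2 / 2 - e p p']
    [= e' p'^2 / 2 - e p^2 / 2 + e (p' - p)^2 / 2]. *)
Lemma energy_step (k nu e e' F : R) (v v' : T -> 'rV[R]_3) (D : T -> 'M[R]_3)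
    (p p' : T -> R) :
  0 < k -> L2v Omega v -> L2v Omega v' -> (forall i j, S (fun x => D x i j)) ->
  S p -> S p' ->
  \int[mu]_(x in Omega) dotv (k^-1 *: (v' x - v x)) (v' x)
    + nu * \int[mu]_(x in Omega) dotm (D x) (D x)
    - \int[mu]_(x in Omega) (p' x * div D x) = F ->
  {ae mu, forall x, Omega x ->
     2^-1 * ((e' * p' x - e * p x) / k) + e / 2 * ((p' x - p x) / k) + div D x = 0} ->
  2^-1 * \int[mu]_(x in Omega) (dotv (v' x) (v' x) + e' * `|p' x| ^+ 2)
  + \int[mu]_(x in Omega)
      (2^-1 * dotv (v' x - v x) (v' x - v x) + e / 2 * (p' x - p x) ^+ 2
       + k * nu * dotm (D x) (D x))
  = 2^-1 * \int[mu]_(x in Omega) (dotv (v x) (v x) + e * `|p x| ^+ 2) + k * F.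
Proof.
move=> k0 Sv Sv' SD Sp Sp' mom cont; have kn0 : k != 0 by rewrite gt_eqF.
have Sd := L2vB Sv' Sv.
have Spd : S (fun x => p' x - p x) by exact: sqintB.
have Ivv := intble_dotv Sv Sv; have Ivv' := intble_dotv Sv' Sv'.
have Idd := intble_dotv Sd Sd; have IDD := intble_dotm SD SD.
have transport : \int[mu]_(x in Omega) dotv (k^-1 *: (v' x - v x)) (v' x) =
    k^-1 / 2 * \int[mu]_(x in Omega) dotv (v' x) (v' x)
    + (- (k^-1 / 2)) * \int[mu]_(x in Omega) dotv (v x) (v x)
    + k^-1 / 2 * \int[mu]_(x in Omega) dotv (v' x - v x) (v' x - v x).
  rewrite -(Rintegral_lin3 mO Ivv' Ivv Idd); apply: eq_Rintegral => x _.
  rewrite /dotv !mulr_sumr -!big_split /=; apply: eq_bigr => i _.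
  by rewrite !mxE; field.
have pressure : \int[mu]_(x in Omega) (p' x * div D x) =
    (- (k^-1 * e' / 2)) * \int[mu]_(x in Omega) (p' x ^+ 2)
    + (k^-1 * e / 2) * \int[mu]_(x in Omega) (p x ^+ 2)
    + (- (k^-1 * e / 2)) * \int[mu]_(x in Omega) ((p' x - p x) ^+ 2).
  rewrite -(Rintegral_lin3 mO Sp'.2 Sp.2 Spd.2); apply/esym/Rintegral_ae_eq => //.
  - apply: (intbleD mO); last exact: intbleZ Spd.2.
    by apply: (intbleD mO); [exact: intbleZ Sp'.2|exact: intbleZ Sp.2].
  - apply: measurable_funM; first exact: Sp'.1.
    rewrite (_ : div D = fun x => \sum_i D x i i) //.
    by apply: measurable_sum => i; exact: (SD i i).1.
  apply: filterS cont => x + Ox => /(_ Ox) /eqP.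
  by rewrite addrC addr_eq0 => /eqP ->; field.
rewrite !Rintegral_kinetic_pressure// Rintegral_lin3//; last exact: Spd.2.
by rewrite -mom transport pressure; field.
Qed.

End VectorFields.

(** * Stability *)

Theorem theorem2p3 (R : realType) (Omega : set (R3 R))
  (Omega_open : open Omega) (Omega_dom : bounded_set Omega \/ Omega = setT)
  (nu : R) (nu_gt0 : 0 < nu)
  (k eps : nat -> R) (k_gt0 : forall n, 0 < k n.+1) (eps_gt0 : forall n, 0 < eps n)
  (f : nat -> (R3 R -> 'rV[R]_3) -> R) (f_Hm1 : forall n, Hm1 Omega (f n.+1))
  (u0 : R3 R -> 'rV[R]_3) (u0_L2 : L2v Omega u0)
  (p0 : R3 R -> R) (p0_L2 : L2 Omega p0)
  (u : nat -> R3 R -> 'rV[R]_3) (Du : nat -> R3 R -> 'M[R]_3)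
  (p : nat -> R3 R -> R)
  (u_L2_0 : L2v Omega (u 0%N))
  (u_H10 : forall n, H10v Omega (u n.+1) (Du n.+1))
  (p_L2 : forall n, L2 Omega (p n))
  (u_init : {ae @mu3 R, forall x, Omega x -> u 0%N x = u0 x})
  (p_init : {ae @mu3 R, forall x, Omega x -> p 0%N x = p0 x})
  (momentum : forall n v Dv, H10v Omega v Dv ->
     \int[@mu3 R]_(x in Omega)
        dotv ((k n.+1)^-1 *: (u n.+1 x - u n x)) (v x)
     + \int[@mu3 R]_(x in Omega)
        dotv (advection (u n.+1) (Du n.+1) x
               + (2^-1 * div (Du n.+1) x) *: u n.+1 x) (v x)
     + nu * \int[@mu3 R]_(x in Omega) dotm (Du n.+1 x) (Dv x)
     - \int[@mu3 R]_(x in Omega) (p n.+1 x * div Dv x)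
     = f n.+1 v)
  (continuity : forall n, {ae @mu3 R, forall x, Omega x ->
     2^-1 * ((eps n.+1 * p n.+1 x - eps n * p n x) / k n.+1)
     + eps n / 2 * ((p n.+1 x - p n x) / k n.+1)
     + div (Du n.+1) x = 0}) :
  forall N : nat, (0 < N)%N ->
    2^-1 * \int[@mu3 R]_(x in Omega) (dotv (u N x) (u N x) + eps N * `|p N x| ^+ 2)
    + \sum_(0 <= n < N)
        \int[@mu3 R]_(x in Omega)
          (2^-1 * dotv (u n.+1 x - u n x) (u n.+1 x - u n x)
           + eps n / 2 * (p n.+1 x - p n x) ^+ 2
           + k n.+1 * nu * dotm (Du n.+1 x) (Du n.+1 x))
    = 2^-1 * \int[@mu3 R]_(x in Omega) (dotv (u0 x) (u0 x) + eps 0%N * `|p0 x| ^+ 2)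
      + \sum_(0 <= n < N) k n.+1 * f n.+1 (u n.+1)
    /\
    2^-1 * \int[@mu3 R]_(x in Omega) (dotv (u N x) (u N x) + eps N * `|p N x| ^+ 2)
    + \sum_(0 <= n < N)
        \int[@mu3 R]_(x in Omega)
          (2^-1 * dotv (u n.+1 x - u n x) (u n.+1 x - u n x)
           + eps n / 2 * (p n.+1 x - p n x) ^+ 2
           + k n.+1 * (nu / 2) * dotm (Du n.+1 x) (Du n.+1 x))
    <= 2^-1 * \int[@mu3 R]_(x in Omega) (dotv (u0 x) (u0 x) + eps 0%N * `|p0 x| ^+ 2)
      + \sum_(0 <= n < N)
          k n.+1 * (1 / (2 * nu)) * fine (Hm1norm Omega (f n.+1)) ^+ 2.
Proof.
have mO := open_measurable3 Omega_open.
have Su n : L2v Omega (u n).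
  by case: n => [|n] //; exact: (H10v_L2v Omega_open (u_H10 n)).
have SDu n i j : sqint (@mu3 R) Omega (fun x => Du n.+1 x i j).
  exact: (H10v_grad Omega_open i j (u_H10 n)).
pose E n := 2^-1 * \int[@mu3 R]_(x in Omega)
  (dotv (u n x) (u n x) + eps n * `|p n x| ^+ 2).
pose W n c := \int[@mu3 R]_(x in Omega)
  (2^-1 * dotv (u n.+1 x - u n x) (u n.+1 x - u n x)
   + eps n / 2 * (p n.+1 x - p n x) ^+ 2
   + k n.+1 * c * dotm (Du n.+1 x) (Du n.+1 x)).
have step n : E n.+1 + W n nu = E n + k n.+1 * f n.+1 (u n.+1).
  apply: (energy_step Omega_open (k_gt0 n)) (continuity n) => //.
  - exact: p_L2.
  - exact: p_L2.
  - by rewrite -(momentum n _ _ (u_H10 n)) (skew_advection Omega_open (u_H10 n)) addr0.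
have E0 : E 0%N = 2^-1 * \int[@mu3 R]_(x in Omega)
    (dotv (u0 x) (u0 x) + eps 0%N * `|p0 x| ^+ 2).
  rewrite /E (Rintegral_kinetic_pressure Omega_open _ u_L2_0 (p_L2 0%N)).
  rewrite (Rintegral_kinetic_pressure Omega_open _ u0_L2 p0_L2).
  congr (_ * (_ + _ * _)).
    apply: (Rintegral_ae_eq mO (intble_dotv Omega_open u_L2_0 u_L2_0)).
      exact: intble_measurable (intble_dotv Omega_open u0_L2 u0_L2).
    by apply: filterS u_init => x ux Ox; rewrite ux.
  apply: (Rintegral_ae_eq mO (p_L2 0%N).2); first exact: intble_measurable p0_L2.2.
  by apply: filterS p_init => x px Ox; rewrite px.
pose G n := \int[@mu3 R]_(x in Omega) dotm (Du n.+1 x) (Du n.+1 x).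
have half n : W n (nu / 2) + k n.+1 * (nu / 2) * G n = W n nu.
  have Sd := L2vB Omega_open (Su n.+1) (Su n).
  have Idd := intble_dotv Omega_open Sd Sd.
  have Ipp := (sqintB mO (p_L2 n.+1) (p_L2 n)).2.
  have IDD := intble_dotm Omega_open (SDu n) (SDu n).
  by rewrite /W !(Rintegral_lin3 mO Idd Ipp IDD) -/(G n); field.
have bound n : k n.+1 * f n.+1 (u n.+1) <= k n.+1 * (1 / (2 * nu)) *
    fine (Hm1norm Omega (f n.+1)) ^+ 2 + k n.+1 * (nu / 2) * G n.
  rewrite -!mulrA -mulrDr; apply: ler_wpM2l; first exact: ltW.
  apply: le_trans (Hm1_le Omega_open (f_Hm1 n) (u_H10 n)) _.
  have -> : G n = L2norm_grad Omega (Du n.+1) ^+ 2.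
    rewrite sqr_sqrtr//; apply: Rintegral_ge0 => x _.
    by apply: sumr_ge0 => i _; apply: sumr_ge0 => j _; rewrite -expr2 sqr_ge0.
  set M := fine _; set s := L2norm_grad _ _.
  (* Young's inequality, with its square defect made explicit. *)
  have -> : 1 * ((2 * nu)^-1 * M ^+ 2) + nu * (2^-1 * s ^+ 2) =
      M * s + (2 * nu)^-1 * (M - nu * s) ^+ 2 by field; rewrite gt_eqF.
  by rewrite lerDl mulr_ge0 ?sqr_ge0// invr_ge0 mulr_ge0 ?ltW.
move=> N _; rewrite -E0 -/(E N); split.
  elim: N => [|N IH]; first by rewrite !big_nil.
  rewrite !big_nat_recr//= addrA [in RHS]addrA -IH -/(W N nu).
  have := step N; lra.
elim: N => [|N IH]; first by rewrite !big_nil.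
rewrite !big_nat_recr//=.
rewrite -/(W N (nu / 2)).
have := step N; have := half N; have := bound N; lra.
Qed.
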